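(* For all $m,n\in\mathbb Z$, $$T_{m,n}(t)=N_{m,n}\,S_{[\lambda,\mu]}(x,y),$$ where $u=|n-m-\frac12|-\frac12$, $v=|n+m-\frac12|-\frac12$, $\lambda=(u,u-1,\ldots,2,1)$, $\mu=(v,v-1,\ldots,2,1)$ (empty if $u=0$, resp. $v=0$), the variables are specialized as $$x_k=\frac{-\kappa_\infty+\sum_i\theta_it_i^k}{k},\qquad y_k=\frac{-\kappa_\infty+\sum_i\theta_it_i^{-k}}{k}\quad(k=1,2,\dots),$$ and $$N_{m,n}=(-1)^{v(v+1)/2}\prod_{i=1}^Nt_i^{v(v+1)/2}\prod_{j=1}^u(2j-1)!!\prod_{k=1}^v(2k-1)!!.$$
   Context: The special polynomials $T_{m,n}=T_{m,n}(t)$, $t=(t_1,\dots,t_N)$, $m,n\in\mathbb Z$, depending on parameters $\kappa_\infty,\theta_1,\dots,\theta_N$, are determined as follows: put $\Phi(T)=\big(\sum_i\frac{t_i^2-1}{t_i}\frac{\partial}{\partial t_i}-2\big)\sum_it_i(t_i^2-1)\frac{\partial}{\partial t_i}\log T+\kappa_\infty\sum_i\theta_i\frac{t_i^2+1}{t_i}-\frac12\sum_{i,j}\theta_i\theta_j\frac{t_i^2+t_j^2}{t_it_j}-\kappa_\infty^2$ (sum over all ordered pairs $(i,j)$); start from $T_{0,0}=T_{0,1}=1$, $T_{1,0}=\sum_i\theta_it_i-\kappa_\infty$, $T_{1,1}=\prod_it_i(\kappa_\infty-\sum_j\theta_jt_j^{-1})$; obtain $T_{m,0},T_{m,1}$ for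 all $m$ from $T_{m+1,n}T_{m-1,n}=\prod_it_i\{\Phi(T_{m,n})+(2m)^2\}T_{m,n}^2$ (forward and backward in $m$); then all $T_{m,n}$ from $T_{m,n+1}T_{m,n-1}=\prod_it_i\{\Phi(T_{m,n})+(2n-1)^2\}T_{m,n}^2$ (forward and backward in $n$). Universal character: for variables $x=(x_1,x_2,\dots)$ define $p_k(x)$ by $\sum_{k\ge0}p_k(x)z^k=\exp(\sum_{k\ge1}x_kz^k)$ and $p_{-k}=0$ for $k>0$; $q_k(y)$ is the same with $y$ in place of $x$. For partitions $\lambda=(\lambda_1,\dots,\lambda_l)$, $\mu=(\mu_1,\dots,\mu_{l'})$, $S_{[\lambda,\mu]}(x,y)=\det(a_{ij})_{1\le i,j\le l+l'}$ with $a_{ij}=q_{\mu_{l'-i+1}+i-j}(y)$ for $1\le i\le l'$ and $a_{ij}=p_{\lambda_{i-l'}-i+j}(x)$ for $l'+1\le i\le l+l'$. *)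

(* Defs.v *)
From HB Require Import structures.
From mathcomp Require Import all_boot all_order all_algebra.
From mathcomp Require Import mpoly.
Set Implicit Arguments. Unset Strict Implicit. Unset Printing Implicit Defensive.
Import Order.TTheory GRing.Theory Num.Theory.
Local Open Scope ring_scope.

(* The ambient field: K = Q(t_1..t_N, kappa_inf, theta_1..theta_N), the field of
   fractions of {mpoly rat[2N+1]}.  Variable layout:
   'X_i = t_(i+1) (i < N), 'X_N = kappa_inf, 'X_(N+1+i) = theta_(i+1). *)
Section Painleve.
Variable N : nat.
Local Notation V := N.*2.+1.
Local Notation P := {mpoly rat[V]}.
Local Notation K := {fraction P}.

Definition tvar (i : 'I_N) : K := tofrac ('X_(inord i) : P).
Definition kinf : K := tofrac ('X_(inord N) : P).
Definition theta (i : 'I_N) : K := tofrac ('X_(inord (N.+1 + i)) : P).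

Definition dfrac (i : 'I_N) (f : K) : K :=
  let r := repr f in
  tofrac ((mderiv (inord i) (frac r).1) * (frac r).2
          - (frac r).1 * (mderiv (inord i) (frac r).2))
  / tofrac (((frac r).2) ^+ 2).

Definition Phi (T : K) : K :=
  let G := \sum_(i < N) tvar i * (tvar i ^+ 2 - 1) * (dfrac i T / T) in
  \sum_(i < N) (tvar i ^+ 2 - 1) / tvar i * dfrac i G - 2 * G
  + kinf * \sum_(i < N) theta i * (tvar i ^+ 2 + 1) / tvar i
  - 2^-1 * \sum_(i < N) \sum_(j < N)
        theta i * theta j * (tvar i ^+ 2 + tvar j ^+ 2) / (tvar i * tvar j)
  - kinf ^+ 2.

Definition step (c : int) (X : K) : K :=
  (\prod_(i < N) tvar i) * (Phi X + (c%:~R) ^+ 2) * X ^+ 2.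

(* two-sided sequence a : int -> K with a_0, a_1 given and
   a_(j+1) a_(j-1) = F j a_j, solved forward (j >= 1) and backward (j <= 0) *)
Fixpoint fwd (F : int -> K -> K) (a0 a1 : K) (k : nat) : K * K :=
  match k with
  | 0 => (a0, a1)
  | k'.+1 => let pq := fwd F a0 a1 k' in (pq.2, F (k'.+1)%:Z pq.2 / pq.1)
  end.
Fixpoint bwd (F : int -> K -> K) (a0 a1 : K) (k : nat) : K * K :=
  match k with
  | 0 => (a0, a1)
  | k'.+1 => let pq := bwd F a0 a1 k' in (F (- (k'%:Z)) pq.1 / pq.2, pq.1)
  end.
Definition bseq (F : int -> K -> K) (a0 a1 : K) (j : int) : K :=
  match j with
  | Posz k => (fwd F a0 a1 k).1
  | Negz k => (bwd F a0 a1 k.+1).1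
  end.

Definition T10 : K := \sum_(i < N) theta i * tvar i - kinf.
Definition T11 : K := (\prod_(i < N) tvar i) * (kinf - \sum_(j < N) theta j / tvar j).

Definition Tcol0 (m : int) : K := bseq (fun j X => step (2 * j) X) 1 T10 m.
Definition Tcol1 (m : int) : K := bseq (fun j X => step (2 * j) X) 1 T11 m.
Definition Tmn (m n : int) : K :=
  bseq (fun j X => step (2 * j - 1) X) (Tcol0 m) (Tcol1 m) n.

Definition xs (k : nat) : K := (- kinf + \sum_(i < N) theta i * tvar i ^+ k) / k%:R.
Definition ys (k : nat) : K := (- kinf + \sum_(i < N) theta i * (tvar i)^-1 ^+ k) / k%:R.

End Painleve.

Section UniChar.
Variable F : fieldType.

(* p_k(x) = coefficient of z^k in exp(sum_{j>=1} x_j z^j)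
          = prod_j sum_m x_j^m z^(j m) / m!  ;  p_k = 0 for k < 0 *)
Definition schurp (x : nat -> F) (k : int) : F :=
  match k with
  | Posz k => \sum_(e : {ffun 'I_k -> 'I_k.+1} | (\sum_(j < k) j.+1 * e j)%N == k)
                 \prod_(j < k) (x j.+1 ^+ e j / ((e j)`!)%:R)
  | Negz _ => 0
  end.

(* universal character S_[lam,mu](x,y), with 0-based row/column indices *)
Definition unichar (x y : nat -> F) (lam mu : seq nat) : F :=
  let l := size lam in let l' := size mu in
  \det (\matrix_(i < l' + l, j < l' + l)
     if (i < l')%N then schurp y ((nth 0%N mu (l' - i.+1))%:Z + i%:Z - j%:Z)
     else schurp x ((nth 0%N lam (i - l'))%:Z - i%:Z + j%:Z)).
End UniChar.

(* |k - 1/2| - 1/2 for an integer k *)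
Definition ufun (k : int) : nat := if (0 < k) then absz (k - 1) else absz k.

Definition stair (u : nat) : seq nat := rev (iota 1 u).

Fixpoint dfact (n : nat) : nat :=
  match n with
  | 0 => 1%N
  | 1 => 1%N
  | S (S k as k1) => (k.+2 * dfact k)%N
  end.

Definition Nmn (N : nat) (m n : int) : {fraction {mpoly rat[N.*2.+1]}} :=
  let u := ufun (n - m) in let v := ufun (n + m) in
  (-1) ^+ ((v * v.+1) %/ 2) * (\prod_(i < N) tvar i) ^+ ((v * v.+1) %/ 2)
  * ((\prod_(1 <= j < u.+1) dfact (2 * j - 1))%N)%:R
  * ((\prod_(1 <= k < v.+1) dfact (2 * k - 1))%N)%:R.

(* Main.v *)
Require Import Defs.
From HB Require Import structures.
From mathcomp Require Import all_boot all_order all_algebra.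
From mathcomp Require Import mpoly.
From mathcomp Require Import ring zify.
Set Implicit Arguments.
Unset Strict Implicit.
Unset Printing Implicit Defensive.
Import Order.TTheory GRing.Theory Num.Theory.
Local Open Scope ring_scope.

(* Put X_k = - kappa + sum_i theta_i t_i^k for every integer k.  The two vector
   fields in Phi act by Dlow X_k = k (X_k - X_(k-2)) and
   Dup X_k = k (X_(k+2) - X_k), and
   Phi(T) = (Dlow - 2) (Dup T / T) - X_1 X_(-1), so the recursions are Toda
   equations for the universal characters of pairs of staircases.

   The rows of the determinant are shifts j |-> p (j - r), j |-> q (s - j), with
   labels r and s in steps of 2.  Hence Dup raises only the largest part of the
   first staircase, all other contributions having two equal rows; padding both
   partitions by zero parts turns the remaining column shifts into scalars.
   Reversing rows and columns exchanges the two partitions as well as the two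
   vector fields, so Dlow acts likewise on the second staircase.  The Toda
   equations then reduce to three-term Pluecker relations.

   The denominators of the recursions do not vanish: at t = 1, theta = 0,
   kappa = 1/2 the vector fields act trivially and the Toda equations become
   products with nonzero factors 1/4 - z^2, z an integer. *)

(** * Derivations *)

HB.mixin Record isLeibniz (R : pzRingType) (D : R -> R) := {
  leibniz_subproof : forall a b, D (a * b) = D a * b + a * D b
}.

#[short(type="derivation")]
HB.structure Definition Derivation (R : pzRingType) :=
  {D of @isLeibniz R D & @GRing.isNmodMorphism R R D}.

Notation "{ 'derivation' R }" := (derivation R)
  (at level 0, format "{ 'derivation'  R }") : type_scope.

Section DerivationTheory.
Variables (R : comPzRingType) (D : {derivation R}).

Lemma derM a b : D (a * b) = D a * b + a * D b.
Proof. exact: leibniz_subproof. Qed.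

Lemma der1 : D 1 = 0.
Proof.
by apply: (addIr (D 1)); have := derM 1 1; rewrite !mulr1 mul1r add0r.
Qed.

Lemma der_nat n : D n%:R = 0.
Proof. by rewrite raddfMn /= der1 mul0rn. Qed.

Lemma der_int (n : int) : D n%:~R = 0.
Proof. by rewrite raddfMz /= der1 mul0rz. Qed.

Lemma derX a n : D (a ^+ n) = n%:R * a ^+ n.-1 * D a.
Proof.
elim: n => [|[|n] IH]; first by rewrite expr0 der1 !mul0r.
  by rewrite expr1 expr0 !mul1r.
by rewrite exprS derM IH /= -[in RHS]natr1 exprS; ring.
Qed.

Lemma der_prod (I : finType) (f : I -> R) :
  D (\prod_i f i) = \sum_i D (f i) * \prod_(k | k != i) f k.
Proof.
elim: (index_enum I) (index_enum_uniq I) => [|a r IH /= /andP[ar /IH {}IH]].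
  by rewrite !big_nil der1.
rewrite !big_cons eqxx derM IH; congr (_ * _ + _).
  rewrite [LHS]big_seq [RHS]big_seq_cond; apply: eq_bigl => k.
  by case: eqVneq ar => [-> /negbTE->|]; rewrite ?andbT.
rewrite mulr_sumr !big_seq; apply: eq_bigr => i ir.
by rewrite big_cons (memPnC ar) // mulrCA.
Qed.

End DerivationTheory.

Section FieldDerivationTheory.
Variables (F : fieldType) (D : {derivation F}).

Lemma derV a : D a^-1 = - D a / a ^+ 2.
Proof.
have [->|a0] := eqVneq a 0; first by rewrite invr0 raddf0 oppr0 mul0r.
apply: (mulfI a0); have := derM D a a^-1; rewrite divff // der1 => /esym/eqP.
by rewrite addrC addr_eq0 => /eqP ->; field.
Qed.

Lemma der_exprz a (n : int) : a != 0 -> D (a ^ n) = n%:~R * (a ^ n / a) * D a.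
Proof.
move=> a0; have powV k : k%:R * a ^+ k.-1 = k%:R * (a ^+ k / a).
  by case: k => [|k]; rewrite ?mul0r // exprS [a * _]mulrC mulfK.
case: n => n; first by rewrite -exprnP derX powV.
rewrite NegzE -exprnN derV derX powV mulrNz.
have := expf_neq0 n.+1 a0; move: (a ^+ _) => b b0.
by rewrite -[n.+1%:~R]/n.+1%:R; field; rewrite b0 a0.
Qed.

Definition logder (a : F) : F := D a / a.

Lemma logderM a b : a != 0 -> b != 0 -> logder (a * b) = logder a + logder b.
Proof. by move=> a0 b0; rewrite /logder derM; field; rewrite a0 b0. Qed.

Lemma logderX a n : a != 0 -> logder (a ^+ n) = n%:R * logder a.
Proof.
move=> a0; elim: n => [|n IH]; first by rewrite /logder der1 !mul0r.
by rewrite exprS logderM ?expf_neq0 // IH -[in RHS]natr1; ring.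
Qed.

End FieldDerivationTheory.

Section PolynomialDerivations.
Variable R : comNzRingType.

HB.instance Definition _ := isLeibniz.Build {poly R} (@deriv R) (@derivM R).

Section CoefficientwiseDerivation.
Variable D : {derivation R}.

Lemma map_poly_leibniz (f g : {poly R}) :
  map_poly D (f * g) = map_poly D f * g + f * map_poly D g.
Proof.
apply/polyP => i; rewrite coefD !coefM coef_map /= coefM raddf_sum -big_split.
by apply: eq_bigr => j _; rewrite /= derM !coef_map.
Qed.

HB.instance Definition _ :=
  isLeibniz.Build {poly R} (map_poly D) map_poly_leibniz.

End CoefficientwiseDerivation.

Definition euler (f : {poly R}) := 'X * f^`().

Lemma euler_zmod_morphism : zmod_morphism euler.
Proof. by move=> f g; rewrite /euler derivB mulrBr. Qed.

Lemma euler_leibniz f g : euler (f * g) = euler f * g + f * euler g.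
Proof. by rewrite /euler derivM; ring. Qed.

HB.instance Definition _ :=
  GRing.isZmodMorphism.Build {poly R} {poly R} euler euler_zmod_morphism.
HB.instance Definition _ := isLeibniz.Build {poly R} euler euler_leibniz.

End PolynomialDerivations.

Lemma raddfZ_invnat (F : fieldType) (U V : lmodType F) (f : {additive U -> V})
  n u : f (n%:R^-1 *: u) = n%:R^-1 *: f u.
Proof.
have [n0|n0] := eqVneq (n%:R : F) 0.
  by rewrite n0 invr0 !scale0r raddf0.
by apply: (scalerI n0); rewrite -raddfZnat !scalerA divff // !scale1r.
Qed.

Lemma pchar0_natf_neq0 (F : fieldType) n :
  has_pchar0 F -> (0 < n)%N -> n%:R != 0 :> F.
Proof. by move=> /pcharf0P->; rewrite lt0n. Qed.

(** * Elementary Schur functions *)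

Section TruncatedExponential.
Variables (F : fieldType) (A : comAlgType F).
Hypothesis pcharF : has_pchar0 F.

Definition truncexp (m : nat) (y : A) : A := \sum_(e < m) e`!%:R^-1 *: y ^+ e.

Lemma der_truncexp (D : {derivation A}) m y :
  D (truncexp m.+1 y) = D y * truncexp m y.
Proof.
rewrite /truncexp big_ord_recl /= !raddfD /= expr0 raddfZ_invnat /= der1.
rewrite scaler0 add0r raddf_sum mulr_sumr; apply: eq_bigr => e _ /=.
rewrite raddfZ_invnat /= derX -mulrA mulr_natl -scaler_nat scalerA -scalerAr.
rewrite [D y * _]mulrC; congr (_ *: _); rewrite factS natrM invfM mulrAC.
by rewrite mulVf ?mul1r // pchar0_natf_neq0.
Qed.

End TruncatedExponential.

Section CoefficientAgreement.
Variable R : nzSemiRingType.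

Definition coef_agree (k : nat) (f g : {poly R}) :=
  forall i, (i < k)%N -> f`_i = g`_i.

Lemma coef_agreeM k f f' g g' :
  coef_agree k f f' -> coef_agree k g g' -> coef_agree k (f * g) (f' * g').
Proof.
move=> hf hg i ik; rewrite !coefM; apply: eq_bigr => j _.
have ji := ltn_ord j.
by rewrite hf ?hg //; lia.
Qed.

Lemma coef_agree_prod k (I : Type) (r : seq I) (f g : I -> {poly R}) :
  (forall j, coef_agree k (f j) (g j)) ->
  coef_agree k (\prod_(j <- r) f j) (\prod_(j <- r) g j).
Proof.
move=> fg; apply: (big_ind2 (coef_agree k)) => // f1 f2 g1 g2.
exact: coef_agreeM.
Qed.

End CoefficientAgreement.

Section TruncatedExponentialCoefficients.
Variable F : fieldType.

Lemma coef_truncexp m (c : F) d i :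
  (truncexp m (c *: 'X^d))`_i =
  \sum_(e < m) e`!%:R^-1 * c ^+ e * (i == (d * e)%N)%:R.
Proof.
rewrite coef_sum; apply: eq_bigr => e _.
by rewrite exprZn -exprM scalerA coefZ coefXn.
Qed.

Lemma truncexp_agree k m m' (c : F) d : (k <= m)%N -> (k <= m')%N ->
  coef_agree k (truncexp m (c *: 'X^(d.+1))) (truncexp m' (c *: 'X^(d.+1))).
Proof.
have cut n : (k <= n)%N ->
    coef_agree k (truncexp n (c *: 'X^(d.+1))) (truncexp k (c *: 'X^(d.+1))).
  move=> kn i ik; rewrite !coef_truncexp.
  rewrite [RHS](big_ord_widen _
    (fun e => e`!%:R^-1 * c ^+ e * (i == (d.+1 * e)%N)%:R) kn).
  rewrite [RHS]big_mkcond; apply: eq_bigr => e _.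
  case: ltnP => // ke; suff /negbTE-> : i != (d.+1 * e)%N by rewrite mulr0.
  by rewrite neq_ltn (leq_trans ik) // (leq_trans ke) // leq_pmull.
by move=> km km' i ik; rewrite (cut m) ?(cut m').
Qed.

Lemma truncexp_agree1 k m (c : F) d : (0 < m)%N -> (k <= d)%N ->
  coef_agree k (truncexp m (c *: 'X^d)) 1.
Proof.
case: m => // m _ kd i ik; rewrite coef_truncexp coef1 big_ord_recl /= big1.
  by rewrite addr0 muln0 expr0 fact0 invr1 !mul1r.
move=> e _; suff /negbTE-> : i != (d * lift ord0 e)%N by rewrite mulr0.
by rewrite neq_ltn (leq_trans ik) // (leq_trans kd) // lift0 leq_pmulr.
Qed.

End TruncatedExponentialCoefficients.

Lemma coef_graded_map (R : nzSemiRingType) (D : {additive {poly R} -> {poly R}})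
    (e : nat -> R -> R) :
  (forall d c, D (c *: 'X^d) = e d c *: 'X^d) ->
  forall f i, (D f)`_i = e i f`_i.
Proof.
move=> De f i; have e0 : e i 0 = 0.
  have := De i 0; rewrite scale0r raddf0 => /(congr1 (coefp i)).
  by rewrite /= coef0 coefZ coefXn eqxx mulr1 => <-.
rewrite -{1}[f]coefK poly_def raddf_sum coef_sum.
under eq_bigr => j _ do rewrite /= De coefZ coefXn.
have [fi|fi] := leqP (size f) i.
  rewrite nth_default // e0 big1 // => j _.
  by rewrite gtn_eqF ?mulr0 // (leq_trans (ltn_ord j)).
rewrite (bigD1 (Ordinal fi)) //= eqxx mulr1 big1 ?addr0 // => j.
by rewrite -val_eqE eq_sym /= => /negbTE->; rewrite mulr0.
Qed.

Section ElementarySchurFunctions.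
Variables (F : fieldType) (x : nat -> F).
Hypothesis pcharF : has_pchar0 F.

Definition expprod (n m : nat) : {poly F} :=
  \prod_(j < n) truncexp m (x j.+1 *: 'X^(j.+1)).

Lemma schurp_coef (k : nat) : schurp x k = (expprod k k.+1)`_k.
Proof.
rewrite /expprod /truncexp bigA_distr_bigA coef_sum [LHS]/= big_mkcond.
apply: eq_bigr => e _.
under [in RHS]eq_bigr => j _ do rewrite exprZn -exprM scalerA -mul_polyC.
rewrite [in RHS]big_split /= -(rmorph_prod polyC) /= coefCM prodrXr coefXn.
rewrite eq_sym; case: ifP => _; rewrite ?mulr0 // mulr1.
by apply: eq_bigr => j _; rewrite mulrC.
Qed.

Lemma expprod_coef n m k : (k <= n)%N -> (k < m)%N ->
  (expprod n m)`_k = schurp x k.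
Proof.
move=> kn km; rewrite schurp_coef; transitivity (expprod n k.+1)`_k.
  by apply: (@coef_agree_prod F k.+1) => // j; apply: truncexp_agree.
elim: n kn => [|n IH]; first by rewrite leqn0 => /eqP->.
rewrite leq_eqVlt => /predU1P[->//|]; rewrite ltnS => kn.
rewrite -IH // /expprod big_ord_recr /= -[in RHS](mulr1 (\prod_(_ < n) _)).
by apply: (@coef_agreeM F k.+1) => //; apply: truncexp_agree1.
Qed.

Lemma der_expprod (D : {derivation {poly F}}) n m :
  coef_agree m (D (expprod n m.+1))
    ((\sum_(j < n) D (x j.+1 *: 'X^(j.+1))) * expprod n m.+1).
Proof.
elim: n => [|n IH]; first by rewrite /expprod !big_ord0 mul0r der1.
rewrite /expprod !big_ord_recr /= -/(expprod n m.+1) derM mulrDl => i im.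
rewrite coefD [RHS]coefD; congr (_ + _).
  by rewrite mulrA; apply: coef_agreeM im.
rewrite der_truncexp // mulrCA; apply: coef_agreeM im => //.
by apply: coef_agreeM => //; apply: truncexp_agree.
Qed.

Lemma schurp0 : schurp x 0 = 1.
Proof. by rewrite schurp_coef /expprod big_ord0 coef1. Qed.

Lemma schurp_neg (k : int) : k < 0 -> schurp x k = 0.
Proof. by case: k. Qed.

(* Both the derivative of p_k along a derivation of F and Euler's identity for
   the weight grading are instances, with D coefficientwise resp. z d/dz. *)
Lemma graded_der_schurp (D : {derivation {poly F}}) (e : nat -> F -> F)
    (k B : nat) :
  (forall d c, D (c *: 'X^d) = e d c *: 'X^d) -> (k <= B)%N ->
  e k (schurp x k) =
  \sum_(j < B) e j.+1 (x j.+1) * schurp x (k%:Z - j.+1%:Z).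
Proof.
move=> De kB; rewrite -(@expprod_coef B k.+2) // -(coef_graded_map De).
rewrite der_expprod // mulr_suml coef_sum.
apply: eq_bigr => j _; rewrite De -scalerAl coefZ coefXnM.
case: ltnP => [kj|jk]; first by rewrite schurp_neg ?mulr0 //; lia.
by rewrite subzn // expprod_coef //; lia.
Qed.

Lemma schurp_euler (k : int) (B : nat) : k <= B%:Z ->
  k%:~R * schurp x k =
  \sum_(j < B) j.+1%:R * x j.+1 * schurp x (k - j.+1%:Z).
Proof.
case: k => k kB; last first.
  by rewrite mulr0 big1 // => j _; rewrite schurp_neg ?mulr0 //; lia.
apply: (graded_der_schurp (D := @euler F) (e := fun d c => d%:R * c)) => // d c.
rewrite /= /euler derivZ derivXn -scaler_nat !scalerA mulrC -scalerAl mulrC.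
by case: d => [|d]; rewrite ?mulr0 ?mul0r ?scale0r // -exprSr.
Qed.

Lemma der_schurp (D : {derivation F}) (k : int) (B : nat) : k <= B%:Z ->
  D (schurp x k) = \sum_(j < B) D (x j.+1) * schurp x (k - j.+1%:Z).
Proof.
case: k => k kB; last first.
  rewrite [schurp x _]/= raddf0 big1 // => j _.
  by rewrite schurp_neg ?mulr0 //; lia.
apply: (graded_der_schurp (D := map_poly D) (e := fun=> D)) => // d c.
apply/polyP => i; rewrite coef_map /= !coefZ coefXn.
by rewrite mulr_natr raddfMn /= mulr_natr.
Qed.

End ElementarySchurFunctions.

Section CompleteFunctions.
Variables (F : fieldType) (X : int -> F).

(* With X_k the power sums, X_k / k are the variables of the Schur functions. *)
Definition complete (k : int) : F := schurp (fun j => X j%:Z / j%:R) k.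

Hypothesis pcharF : has_pchar0 F.
Local Notation p := complete.

Lemma complete0 : p 0 = 1.
Proof. exact: schurp0. Qed.

Lemma complete_neg k : k < 0 -> p k = 0.
Proof. exact: schurp_neg. Qed.

Lemma complete_euler (k : int) (B : nat) : k <= B%:Z ->
  k%:~R * p k = \sum_(j < B) X j.+1%:Z * p (k - j.+1%:Z).
Proof.
move=> kB; rewrite /p (schurp_euler _ pcharF kB); apply: eq_bigr => j _.
by rewrite mulrCA divff ?mulr1 // pchar0_natf_neq0.
Qed.

Lemma complete1 : p 1 = X 1.
Proof.
have := @complete_euler 1 1%N (lexx _).
by rewrite big_ord1 mul1r complete0 mulr1.
Qed.

Lemma complete2 : p 2 *+ 2 = X 2 + X 1 ^+ 2.
Proof.
have := @complete_euler 2 2%N (lexx _).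
rewrite -[p 2 *+ 2]mulr_natl !big_ord_recl big_ord0 addr0 addrC => ->.
by rewrite [_ - _]/(0 : int) [_ - _]/(1 : int) complete0 complete1 mulr1.
Qed.

Definition raises (D : F -> F) := forall k, D (X k) = k%:~R * (X (k + 2) - X k).
Definition lowers (D : F -> F) := forall k, D (X k) = k%:~R * (X k - X (k - 2)).

Variable D : {derivation F}.

Lemma der_complete_powersums (c : int -> F) (k : int) (B : nat) :
  (forall j, D (X j) = j%:~R * c j) -> k <= B%:Z ->
  D (p k) = \sum_(j < B) c j.+1%:Z * p (k - j.+1%:Z).
Proof.
move=> DX kB; rewrite /p (der_schurp _ pcharF D kB); apply: eq_bigr => j _.
rewrite derM derV der_nat oppr0 mul0r mulr0 addr0 DX; congr (_ * _).
by rewrite mulrAC divff ?mul1r // pchar0_natf_neq0.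
Qed.

Lemma der_complete_raises : raises D -> forall k,
  D (p k) = (k + 2)%:~R * p (k + 2) - X 1 * p (k + 1) - (X 2 + k%:~R) * p k.
Proof.
move=> DX k.
have kB : k <= `|k|%N%:Z by lia.
have kB2 : k + 2 <= `|k|%N.+2%:Z by lia.
rewrite (der_complete_powersums DX kB) (complete_euler kB2) mulrDl.
rewrite (complete_euler kB) 2!big_ord_recl /=.
under eq_bigr do rewrite mulrBl; rewrite sumrB.
have -> : k + 2 - 1 = k + 1 by ring.
have -> : k + 2 - 2 = k by ring.
under [in RHS]eq_bigr => j _.
  have -> : k + 2 - (bump 0 (bump 0 j)).+1%:Z = k - j.+1%:Z.
    by rewrite /bump; lia.
  have -> : (bump 0 (bump 0 j)).+1%:Z = j.+1%:Z + 2 by rewrite /bump; lia.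
  over.
by ring.
Qed.

Lemma der_complete_lowers : lowers D -> forall k,
  D (p k) = k%:~R * p k - X (-1) * p (k - 1) - ((k - 2)%:~R + X 0) * p (k - 2).
Proof.
move=> DX k.
have kB : k <= `|k|%N.+2%:Z by lia.
have kB2 : k - 2 <= `|k|%N%:Z by lia.
rewrite (der_complete_powersums DX kB) (complete_euler kB) mulrDl.
rewrite (complete_euler kB2).
under eq_bigr do rewrite mulrBl; rewrite sumrB.
rewrite [X in _ - X]big_ord_recl big_ord_recl /=.
under [in X in _ - X]eq_bigr => j _.
  have -> : k - (bump 0 (bump 0 j)).+1%:Z = k - 2 - j.+1%:Z.
    by rewrite /bump; lia.
  have -> : (bump 0 (bump 0 j)).+1%:Z - 2 = j.+1%:Z by rewrite /bump; lia.
  over.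
by rewrite [_ - 2]/(-1 : int) [_ - 2]/(0 : int); ring.
Qed.

End CompleteFunctions.

Arguments complete {F} X k : simpl never.

Section OppositeIndices.
Variables (F : fieldType) (X Y : int -> F) (D : F -> F).
Hypothesis YX : forall k, Y k = X (- k).

Lemma lowers_opp : raises X D -> lowers Y D.
Proof.
by move=> DX k; rewrite !YX DX intrN (_ : - (k - 2) = - k + 2); ring.
Qed.

Lemma raises_opp : lowers X D -> raises Y D.
Proof.
by move=> DX k; rewrite !YX DX intrN (_ : - (k + 2) = - k - 2); ring.
Qed.

End OppositeIndices.

(** * Determinants with labelled rows *)

Section RowReplacement.
Variables (R : comNzRingType) (n : nat).
Implicit Types (A B E W : 'M[R]_n) (u v : 'rV[R]_n) (i k : 'I_n).

Definition setrow A i v : 'M[R]_n :=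
  \matrix_(r, s) if r == i then v 0 s else A r s.

Lemma det_setrow A i v : \det (setrow A i v) = (v *m \adj A) 0 i.
Proof.
rewrite (expand_det_row _ i) mxE; apply: eq_bigr => j _; rewrite !mxE eqxx.
congr (_ * (_ * \det _)); apply/matrixP => r s; rewrite !mxE.
by rewrite eq_sym (negbTE (neq_lift _ _)).
Qed.

Lemma det_setrow_row A i k : \det (setrow A i (row k A)) = (k == i)%:R * \det A.
Proof. by rewrite det_setrow -row_mul mul_mx_adj !mxE mulr_natl. Qed.

Lemma setrow_row A i : setrow A i (row i A) = A.
Proof. by apply/matrixP => r s; rewrite !mxE; case: eqP => [->|]. Qed.

Lemma det_setrow_swap A i k v : i != k ->
  \det (setrow (setrow A k v) i (row k A)) = - \det (setrow A i v).
Proof.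
move=> ik.
have -> : setrow (setrow A k v) i (row k A) = xrow i k (setrow A i v) :> 'M_n.
  apply/matrixP => r s; rewrite !mxE.
  case: perm.tpermP => [->|->|/eqP/negbTE-> /eqP/negbTE->] //.
    by rewrite eqxx eq_sym (negbTE ik).
  by rewrite eq_sym (negbTE ik) !eqxx.
by rewrite xrowE det_mulmx /tperm_mx det_perm perm.odd_tperm ik expr1 mulN1r.
Qed.

Lemma sum_det_setrow A E :
  \sum_i \det (setrow A i (row i E)) = \tr (E *m \adj A).
Proof. by apply: eq_bigr => i _; rewrite det_setrow -row_mul mxE. Qed.

Lemma mxtrace_mul_adjl A W : \tr (W *m A *m \adj A) = \tr W * \det A.
Proof. by rewrite -mulmxA mul_mx_adj mul_mx_scalar mxtraceZ mulrC. Qed.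

Lemma mxtrace_mul_adjr A W : \tr (A *m W *m \adj A) = \tr W * \det A.
Proof.
by rewrite mxtrace_mulC mulmxA mul_adj_mx mul_scalar_mx mxtraceZ mulrC.
Qed.

Lemma der_det (D : {derivation R}) A :
  D (\det A) = \tr (map_mx D A *m \adj A).
Proof.
rewrite -sum_det_setrow raddf_sum exchange_big /=; apply: eq_bigr => s _.
rewrite derM derX raddfN /= der1 oppr0 mulr0 mul0r add0r -mulr_sumr der_prod.
congr (_ * _); apply: eq_bigr => i _; rewrite [RHS](bigD1 i) //= !mxE eqxx.
by congr (_ * _); apply: eq_bigr => k /negbTE ki; rewrite mxE ki.
Qed.

(* det A * x is the combination of the rows of A with coefficients
   det (A with x in row l); expand the determinant on the left along it. *)
Lemma det_plucker A i k x y : i != k ->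
  \det A * \det (setrow (setrow A k y) i x) =
  \det (setrow A i x) * \det (setrow A k y)
  - \det (setrow A k x) * \det (setrow A i y).
Proof.
move=> ik; set B := setrow A k y.
have rowB l : l != k -> row l A = row l B.
  by move=> lk; apply/rowP => s; rewrite !mxE (negbTE lk).
have -> : \det A * \det (setrow B i x) =
    \sum_l \det (setrow A l x) * \det (setrow B i (row l A)).
  transitivity ((x *m \adj A *m (A *m \adj B)) 0 i).
    rewrite -!mulmxA [\adj A *m _]mulmxA mul_adj_mx mul_scalar_mx.
    by rewrite -scalemxAr mxE det_setrow.
  rewrite mxE; apply: eq_bigr => l _.
  by rewrite !det_setrow -row_mul [row _ _ _ _]mxE.
rewrite (bigD1 i) //= rowB // setrow_row (bigD1 k) 1?eq_sym //=.
rewrite det_setrow_swap // mulrN big1 ?addr0 // => l /andP[li lk].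
by rewrite rowB // det_setrow_row (negbTE li) mul0r mulr0.
Qed.

End RowReplacement.

Lemma det_rev (R : comNzRingType) n (A : 'M[R]_n) :
  \det (\matrix_(i, j) A (rev_ord i) (rev_ord j)) = \det A.
Proof.
pose s := perm.perm (@rev_ord_inj n).
have -> : \matrix_(i, j) A (rev_ord i) (rev_ord j) = row_perm s (col_perm s A).
  by apply/matrixP => i j; rewrite !mxE !perm.permE.
rewrite row_permE col_permE !det_mulmx !det_perm perm.odd_permV mulrCA.
by rewrite -expr2 sqrr_sign mulr1.
Qed.

(* The label (true, r) stands for the row j |-> p (j - r) of a determinant, and
   (false, s) for the row j |-> q (s - j). *)
Definition label := (bool * int)%type.

Definition label_shift (c : int) (l : label) : label := (l.1, l.2 + c).

Definition with_label (L : nat -> label) (k : nat) (l : label) : nat -> label :=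
  fun i => if i == k then l else L i.

(* Reversing the rows and columns of a determinant of size M exchanges p and q
   and dualises the labels. *)
Definition label_dual (M : nat) (l : label) : label := (~~ l.1, M.-1%:Z - l.2).

Definition dual_labels (M : nat) (L : nat -> label) : nat -> label :=
  fun i => label_dual M (L (M - i.+1)%N).

Definition rotate_labels (s k : nat) (L : nat -> label) : nat -> label :=
  fun i => if (i < s)%N then L i else if (i < s + k)%N then L i.+1
           else if i == (s + k)%N then L s else L i.

Lemma label_dual_shift M c l :
  label_dual M (label_shift c l) = label_shift (- c) (label_dual M l).
Proof. by rewrite /label_dual /label_shift /=; congr (_, _); ring. Qed.

Lemma dual_with_label M L k l i : (k < M)%N -> (i < M)%N ->
  dual_labels M (with_label L k l) i =
  with_label (dual_labels M L) (M - k.+1) (label_dual M l) i.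
Proof.
move=> kM iM; rewrite /dual_labels /with_label.
have -> : (i == M - k.+1)%N = (M - i.+1 == k)%N by lia.
by case: ifP.
Qed.

Definition unit_series (R : pzSemiRingType) (p : int -> R) :=
  p 0 = 1 /\ forall k, k < 0 -> p k = 0.

Section LabelledDeterminants.
Variables (R : comNzRingType) (p q : int -> R).
Implicit Types (L : nat -> label) (l : label).

Definition lrow (l : label) (j : int) : R :=
  if l.1 then p (j - l.2) else q (l.2 - j).

Definition lmx (M : nat) (L : nat -> label) : 'M[R]_M :=
  \matrix_(i < M, j < M) lrow (L i) j%:Z.

Definition ldet (M : nat) (L : nat -> label) : R := \det (lmx M L).

Lemma lrow_shift c l j : lrow (label_shift c l) j = lrow l (j - c).
Proof. by case: l => [[] r]; rewrite /lrow /=; congr (_ _); ring. Qed.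

Lemma ldet_ext M L L' : (forall i, (i < M)%N -> L i = L' i) ->
  ldet M L = ldet M L'.
Proof.
by move=> LL'; congr (\det _); apply/matrixP => i j; rewrite !mxE LL'.
Qed.

Lemma lmx_with_label M L (k : 'I_M) l :
  lmx M (with_label L k l) = setrow (lmx M L) k (\row_j lrow l j%:Z).
Proof.
by apply/matrixP => i j; rewrite !mxE /with_label val_eqE; case: ifP.
Qed.

Lemma row_lmx M L (i : 'I_M) : row i (lmx M L) = \row_j lrow (L i) j%:Z.
Proof. by apply/rowP => j; rewrite !mxE. Qed.

Lemma ldet_repeated_label M L k i : (k < M)%N -> (i < M)%N -> i != k ->
  ldet M (with_label L k (L i)) = 0.
Proof.
move=> kM iM ik; rewrite /ldet (lmx_with_label L (Ordinal kM)).
rewrite -(row_lmx L (Ordinal iM)) det_setrow_row -val_eqE /=.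
by rewrite (negbTE ik) mul0r.
Qed.

Lemma ldet_zero_label M L k l : (k < M)%N ->
  (forall j : nat, (j < M)%N -> lrow l j = 0) -> ldet M (with_label L k l) = 0.
Proof.
move=> kM l0; rewrite /ldet (lmx_with_label L (Ordinal kM)) det_setrow mxE.
by rewrite big1 // => j _; rewrite mxE l0 ?mul0r.
Qed.

Lemma ldet_plucker M L i k x y : (i < M)%N -> (k < M)%N -> i != k ->
  ldet M L * ldet M (with_label (with_label L k y) i x) =
  ldet M (with_label L i x) * ldet M (with_label L k y)
  - ldet M (with_label L k x) * ldet M (with_label L i y).
Proof.
move=> iM kM ik; rewrite /ldet.
rewrite !(lmx_with_label _ (Ordinal iM)) !(lmx_with_label _ (Ordinal kM)).
exact: det_plucker.
Qed.

Lemma sum_ldet_shift M L c :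
  \sum_(i < M) ldet M (with_label L i (label_shift (- c) (L i))) =
  \tr (lmx M (label_shift (- c) \o L) *m \adj (lmx M L)).
Proof.
rewrite -sum_det_setrow; apply: eq_bigr => i _.
by rewrite /ldet lmx_with_label row_lmx.
Qed.

Lemma weighted_sum_ldet_shift M L c (w : nat -> R) :
  \sum_(i < M) w i * ldet M (with_label L i (label_shift (- c) (L i))) =
  \tr (diag_mx (\row_i w i) *m lmx M (label_shift (- c) \o L)
       *m \adj (lmx M L)).
Proof.
rewrite -sum_det_setrow; apply: eq_bigr => i _.
rewrite /ldet lmx_with_label !det_setrow mul_diag_mx !mxE mulr_sumr.
by apply: eq_bigr => j _; rewrite !mxE mulrA.
Qed.

Lemma ldet_rotate M s k L : (s + k < M)%N ->
  ldet M (rotate_labels s k L) = (-1) ^+ k * ldet M L.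
Proof.
elim: k => [|k IH] skM.
  rewrite expr0 mul1r; apply: ldet_ext => i _; rewrite /rotate_labels addn0.
  by case: ltngtP => // ->.
have sk : (s + k < M)%N by lia.
have sk1 : ((s + k).+1 < M)%N by lia.
rewrite exprS -mulrA -IH // mulN1r /ldet.
pose i := Ordinal sk; pose i' := Ordinal sk1.
have ii' : i != i' by rewrite -val_eqE /= neq_ltn leqnn.
have -> : lmx M (rotate_labels s k.+1 L) =
    xrow i i' (lmx M (rotate_labels s k L)).
  apply/matrixP => r j; rewrite !mxE; congr (lrow _ _).
  rewrite /rotate_labels addnS.
  case: perm.tpermP => [->|->|/eqP ri /eqP ri'] /=.
  - by do ?case: ifP => //; lia.
  - by do ?case: ifP => //; lia.
  rewrite -!val_eqE /= in ri ri'.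
  by do ?case: ifP => //; lia.
by rewrite xrowE det_mulmx /tperm_mx det_perm perm.odd_tperm ii' expr1 mulN1r.
Qed.

Lemma ldet_strip_bot M L : unit_series q -> L 0%N = (false, 0) ->
  ldet M.+1 L = ldet M (fun i => label_shift (-1) (L i.+1)).
Proof.
move=> [q0 qN] L0; rewrite /ldet (expand_det_row _ ord0) big_ord_recl big1.
  rewrite addr0 mxE L0 /lrow /= subrr q0 mul1r /cofactor expr0 mul1r.
  congr (\det _); apply/matrixP => i j; rewrite !mxE lrow_shift !lift0.
  by congr (lrow _ _); lia.
by move=> j _; rewrite mxE L0 /lrow /= qN ?mul0r //; rewrite /bump /=; lia.
Qed.

Lemma ldet_strip_top M L : unit_series p -> L M = (true, M%:Z) ->
  ldet M.+1 L = ldet M L.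
Proof.
move=> [p0 pN] LM; rewrite /ldet (expand_det_row _ ord_max) big_ord_recr /=.
rewrite big1.
  rewrite add0r mxE /= LM /lrow /= subrr p0 mul1r /cofactor /= addnn.
  rewrite -signr_odd odd_double expr0 mul1r; congr (\det _).
  by apply/matrixP => i j; rewrite !mxE !lift_max.
by move=> j _; rewrite mxE /= LM /lrow /= pN ?mul0r //; have := ltn_ord j; lia.
Qed.

Definition top_labels (m : nat) (L : nat -> label) :=
  L m.+1 = (true, m.+1%:Z) /\ L m = (true, m%:Z).

Lemma row_adj_top m L : unit_series p -> top_labels m L ->
  let penult := widen_ord (leqnSn _) ord_max in
  row ord_max (\adj (lmx m.+2 L)) = ldet m.+2 L *: delta_mx 0 ord_max /\
  row penult (\adj (lmx m.+2 L)) =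
  ldet m.+2 L *: (delta_mx 0 penult - p 1 *: delta_mx 0 ord_max).
Proof.
move=> [p0 pN] [Lm1 Lm] penult; rewrite /ldet; set A := lmx _ L.
have rowA i : row i A *m \adj A = \det A *: delta_mx 0 i.
  by rewrite -row_mul mul_mx_adj -scalemx1 linearZ /= row1.
have row_last : row ord_max A = delta_mx 0 ord_max.
  apply/rowP => j; rewrite !mxE Lm1 /lrow /= -val_eqE /=.
  case: eqP => [->|/eqP jm]; first by rewrite subrr p0.
  by rewrite pN //; have := ltn_ord j; lia.
have row_penult : row penult A = delta_mx 0 penult + p 1 *: delta_mx 0 ord_max.
  apply/rowP => j; rewrite !mxE Lm /lrow /= -!val_eqE /=; have := ltn_ord j.
  case: (ltngtP j m) => jm jm2.
  - by rewrite pN ?ltn_eqF ?mulr0 ?addr0 //; lia.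
  - have -> : j = m.+1 :> nat by lia.
    by rewrite eqxx add0r mulr1; congr p; lia.
  by rewrite jm subrr p0 ltn_eqF // mulr0 addr0.
have adj_last : row ord_max (\adj A) = \det A *: delta_mx 0 ord_max.
  by rewrite rowE -{1}row_last rowA.
split=> //; have := rowA penult; rewrite row_penult mulmxDl -scalemxAl -!rowE.
rewrite adj_last => /(canRL (addrK _))->.
by rewrite scalerBr !scalerA mulrC.
Qed.

Lemma mxtrace_weighted_colshift m L (c : int) (w : nat -> R) :
  unit_series p -> top_labels m L -> 0 < c <= 2 ->
  \tr (lmx m.+2 (label_shift (- c) \o L) *m diag_mx (\row_j w j)
       *m \adj (lmx m.+2 L)) =
  (w m * (p c - p 1 * p (c - 1)) + w m.+1 * p c) * ldet m.+2 L.
Proof.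
case: c => [c|//] p_series topL c12.
have [adj_last adj_penult] := row_adj_top p_series topL.
case: topL => Lm1 Lm; move: adj_last adj_penult.
set A := lmx _ L; set Ac := lmx _ (_ \o _) => adj_last adj_penult.
have entry i j : (\adj A *m Ac) i j = (row i (\adj A) *m Ac) 0 j.
  by rewrite -row_mul [RHS]mxE.
rewrite mxtrace_mulC mulmxA mul_mx_diag.
transitivity (\sum_j (\adj A *m Ac) j j * w j).
  by apply: eq_bigr => j _; rewrite !mxE.
rewrite !big_ord_recr /= big1 ?add0r => [|j _].
  rewrite !entry adj_penult adj_last -!scalemxAl mulmxBl -scalemxAl -!rowE.
  rewrite !mxE /= !lrow_shift !opprK Lm1 Lm /lrow /= /ldet -/A.
  have -> : m%:Z + c%:Z - m%:Z = c by ring.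
  have -> : m.+1%:Z + c%:Z - m.+1%:Z = c by ring.
  have -> : m%:Z + c%:Z - m.+1%:Z = c%:Z - 1 by lia.
  by ring.
have jcM : (j + c < m.+2)%N by have := ltn_ord j; lia.
set j' := widen_ord _ _.
have -> : (\adj A *m Ac) j' j' = (\adj A *m A) j' (Ordinal jcM).
  rewrite !mxE; apply: eq_bigr => i _; congr (_ * _).
  by rewrite !mxE lrow_shift opprK.
by rewrite mul_adj_mx mxE -val_eqE /= ltn_eqF ?mulr0n ?mul0r //; lia.
Qed.

Lemma mxtrace_colshift m L (c : int) :
  unit_series p -> top_labels m L -> 0 < c <= 2 ->
  \tr (lmx m.+2 (label_shift (- c) \o L) *m \adj (lmx m.+2 L)) =
  (p c *+ 2 - p 1 * p (c - 1)) * ldet m.+2 L.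
Proof.
move=> p_series topL c12.
have := mxtrace_weighted_colshift (fun=> 1) p_series topL c12.
have -> : diag_mx (\row_(j < m.+2) 1) = 1%:M :> 'M[R]_m.+2.
  by apply/matrixP => i j; rewrite !mxE.
by rewrite mulmx1 => ->; ring.
Qed.

End LabelledDeterminants.

Lemma ldet_dual (R : comNzRingType) (p q : int -> R) M L :
  ldet q p M (dual_labels M L) = ldet p q M L.
Proof.
rewrite -[RHS]det_rev; congr (\det _); apply/matrixP => i j; rewrite !mxE /=.
have iM := ltn_ord i; have jM := ltn_ord j.
by rewrite /dual_labels /lrow /=; case: (L _) => [[] r] /=; congr (_ _); lia.
Qed.

Definition nlabels (b : bool) (M : nat) (L : nat -> label) : nat :=
  \sum_(i < M) ((L i).1 == b).

Definition displacement (M : nat) (L : nat -> label) : int :=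
  \sum_(i < M) ((L i).2 - i%:Z).

Lemma nlabels_true_false M L : (nlabels true M L + nlabels false M L)%N = M.
Proof.
rewrite -big_split /= -[RHS]card_ord -sum1_card.
by apply: eq_bigr => i _; case: (L i).1.
Qed.

Lemma nlabels_dual b M L : nlabels b M (dual_labels M L) = nlabels (~~ b) M L.
Proof.
rewrite /nlabels [RHS](reindex_inj rev_ord_inj); apply: eq_bigr => i _ /=.
by rewrite /dual_labels /=; case: (L _).1 b => [] [].
Qed.

Lemma displacement_dual M L :
  displacement M (dual_labels M L) = - displacement M L.
Proof.
rewrite /displacement [in RHS](reindex_inj rev_ord_inj) -sumrN.
by apply: eq_bigr => i _; rewrite /dual_labels /=; have := ltn_ord i; lia.
Qed.

Section LabelledDerivatives.
Variables (F : fieldType) (X Y : int -> F).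
Hypothesis pcharF : has_pchar0 F.
Hypothesis YX : forall k, Y k = X (- k).

Local Notation p := (complete X).
Local Notation q := (complete Y).
Local Notation row := (lrow p q).
Local Notation det := (ldet p q).

Lemma unit_series_complete (Z : int -> F) : unit_series (complete Z).
Proof. by split=> [|k]; [exact: complete0 | exact: complete_neg]. Qed.

(* The rule of Murnaghan and Nakayama for the power sum X_2. *)
Lemma sum_ldet_shift2 m (L : nat -> label) : top_labels m L ->
  \sum_(i < m.+2) det m.+2 (with_label L i (label_shift (-2) (L i))) =
  X 2 * det m.+2 L.
Proof.
move=> topL; rewrite (sum_ldet_shift p q _ L 2).
rewrite (mxtrace_colshift q (c := 2) (unit_series_complete X) topL) //.
by rewrite [2 - 1]/(1 : int) (complete2 X pcharF) complete1 // expr2 addrK.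
Qed.

Variable D : {derivation F}.
Hypothesis DX : raises X D.

Lemma der_lrow (l : label) (j : int) : D (row l j) =
  (j - l.2 + 2)%:~R * row l (j + 2) - (j - l.2)%:~R * row l j
  - X 1 * row l (j + 1) - (if l.1 then X 2 * row l j else X 0 * row l (j + 2)).
Proof.
case: l => [[] r]; rewrite /lrow /=.
  rewrite (der_complete_raises pcharF DX).
  have -> : j + 2 - r = j - r + 2 by ring.
  have -> : j + 1 - r = j - r + 1 by ring.
  by ring.
rewrite (der_complete_lowers pcharF (lowers_opp YX DX)) !YX opprK oppr0.
have -> : r - (j + 2) = r - j - 2 by ring.
have -> : r - (j + 1) = r - j - 1 by ring.
by ring.
Qed.

Lemma map_der_lmx M (L : nat -> label) : map_mx D (lmx p q M L) =
  lmx p q M (label_shift (-2) \o L) *m diag_mx (\row_j j.+2%:R)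
  - lmx p q M L *m diag_mx (\row_j j%:R)
  + diag_mx (\row_i ((L i).2%:~R - X 2 * ((L i).1 == true)%:R)) *m lmx p q M L
  - diag_mx (\row_i ((L i).2%:~R + X 0 * ((L i).1 == false)%:R))
    *m lmx p q M (label_shift (-2) \o L)
  - X 1 *: lmx p q M (label_shift (-1) \o L).
Proof.
apply/matrixP => i j; rewrite !mul_mx_diag !mul_diag_mx !mxE der_lrow /=.
rewrite !lrow_shift !opprK; case: (L i) => b r /=.
by case: b => /=; ring.
Qed.

Lemma der_ldet_raises m (L : nat -> label) : top_labels m L ->
  D (det m.+2 L) =
  ((X 2 - X 1 ^+ 2) / 2 + (displacement m.+2 L)%:~R) * det m.+2 L
  + \sum_(i < m.+2) ((nlabels false m.+2 L)%:R - (L i).2%:~R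
                     - X 0 * ((L i).1 == false)%:R)
      * det m.+2 (with_label L i (label_shift (-2) (L i))).
Proof.
move=> topL; have p_series := unit_series_complete X.
set n := nlabels _ _ _; set detL := det m.+2 L.
pose moved i := det m.+2 (with_label L i (label_shift (-2) (L i))).
pose s i : F := (L i).2%:~R + X 0 * ((L i).1 == false)%:R.
have -> : \sum_(i < m.+2) (n%:R - (L i).2%:~R - X 0 * ((L i).1 == false)%:R)
      * moved i = n%:R * X 2 * detL - \sum_(i < m.+2) s i * moved i.
  rewrite -mulrA -(sum_ldet_shift2 topL) mulr_sumr -sumrB.
  by apply: eq_bigr => i _; rewrite /s /moved; ring.
have trN A : \tr (- A) = - \tr A :> F by exact: raddfN.
rewrite der_det map_der_lmx.
rewrite !(mulmxDl, mulNmx) -scalemxAl !(mxtraceD, trN) mxtraceZ.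
rewrite (weighted_sum_ldet_shift p q _ L 2 s).
rewrite (mxtrace_weighted_colshift q (c := 2) (fun j => j.+2%:R) p_series topL)
  //.
rewrite (mxtrace_colshift q (c := 1) p_series topL) //.
rewrite mxtrace_mul_adjr !mxtrace_mul_adjl [2 - 1]/(1 : int) subrr.
rewrite complete0 complete1 // !mxtrace_diag -/(ldet _ _ _ _) -/detL.
set rowsum := \sum_j (\row_i (_ - _)) 0 j; set colsum := \sum_j _ 0 j.
have diag_sums : rowsum - colsum =
    (displacement m.+2 L)%:~R - X 2 * (nlabels true m.+2 L)%:R.
  rewrite rmorph_sum natr_sum mulr_sumr -!sumrB; apply: eq_bigr => i _.
  by rewrite !mxE /= intrB -pmulrn; ring.
have p2 : p 2 = (X 2 + X 1 ^+ 2) / 2.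
  by rewrite -complete2 // -[p 2 *+ 2]mulr_natr mulfK // pchar0_natf_neq0.
have labelsE : m.+2%:R = (nlabels true m.+2 L)%:R + n%:R :> F.
  by rewrite -natrD nlabels_true_false.
rewrite -[m.+3%:R]natr1 labelsE p2 -[rowsum](subrK colsum) diag_sums.
by field; apply: pchar0_natf_neq0.
Qed.

End LabelledDerivatives.

Definition bottom_labels (L : nat -> label) :=
  L 0%N = (false, 0) /\ L 1%N = (false, 1).

Lemma top_labels_dual m L :
  bottom_labels L -> top_labels m (dual_labels m.+2 L).
Proof.
move=> [L0 L1]; rewrite /top_labels /dual_labels subnn subSnn L0 L1.
by split; rewrite /label_dual /=; congr (_, _); lia.
Qed.

Lemma ldet_dual_with_label (R : comNzRingType) (p q : int -> R) M L
    (i : 'I_M) l :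
  ldet q p M (with_label (dual_labels M L) (rev_ord i) (label_dual M l)) =
  ldet p q M (with_label L i l).
Proof.
rewrite -[RHS]ldet_dual; apply: ldet_ext => k kM.
by rewrite dual_with_label.
Qed.

Section LoweredDeterminants.
Variables (F : fieldType) (X Y : int -> F).
Hypothesis pcharF : has_pchar0 F.
Hypothesis YX : forall k, Y k = X (- k).

Local Notation det := (ldet (complete X) (complete Y)).

Lemma dual_labels_rev M (L : nat -> label) (i : 'I_M) :
  dual_labels M L (rev_ord i) = label_dual M (L i).
Proof.
by congr (label_dual _ (L _)); have := ltn_ord i; rewrite /=; lia.
Qed.

Lemma sum_ldet_shiftN2 m (L : nat -> label) : bottom_labels L ->
  \sum_(i < m.+2) det m.+2 (with_label L i (label_shift 2 (L i))) =
  Y 2 * det m.+2 L.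
Proof.
move=> botL; have topL := top_labels_dual m botL.
rewrite -ldet_dual -(sum_ldet_shift2 Y X pcharF topL).
rewrite [RHS](reindex_inj rev_ord_inj); apply: eq_bigr => i _.
by rewrite dual_labels_rev -label_dual_shift ldet_dual_with_label.
Qed.

Lemma der_ldet_lowers (D : {derivation F}) m (L : nat -> label) :
  lowers X D -> bottom_labels L ->
  D (det m.+2 L) =
  ((Y 2 - Y 1 ^+ 2) / 2 - (displacement m.+2 L)%:~R) * det m.+2 L
  + \sum_(i < m.+2) ((nlabels true m.+2 L)%:R - (m.+1%:Z - (L i).2)%:~R
                     - X 0 * ((L i).1 == true)%:R)
      * det m.+2 (with_label L i (label_shift 2 (L i))).
Proof.
move=> DX botL; have XY k : X k = Y (- k) by rewrite YX opprK.
have topL := top_labels_dual m botL.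
rewrite -ldet_dual (der_ldet_raises pcharF XY (raises_opp YX DX) topL).
rewrite displacement_dual nlabels_dual intrN; congr (_ + _).
rewrite (reindex_inj rev_ord_inj); apply: eq_bigr => i _.
rewrite dual_labels_rev -label_dual_shift ldet_dual_with_label XY oppr0.
by rewrite /label_dual /=; case: (L i).1.
Qed.

End LoweredDeterminants.

(** * Staircases and the Toda equations *)

Lemma sum_ord_supp (V : nmodType) M (G : nat -> V) (s : seq nat) :
  uniq s -> all (fun k => k < M)%N s ->
  (forall i, (i < M)%N -> i \notin s -> G i = 0) ->
  \sum_(i < M) G i = \sum_(i <- s) G i.
Proof.
move=> s_uniq /allP sM G0; rewrite -(big_mkord xpredT) (bigID (mem s)) /=.
rewrite [X in _ + X]big_seq_cond [X in _ + X]big1 ?addr0 => [|i].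
  rewrite -big_filter; apply: perm_big; apply: uniq_perm => // [|i].
    by rewrite filter_uniq ?iota_uniq.
  rewrite mem_filter mem_index_iota /=.
  by case: (boolP (i \in s)) => // /sM.
by rewrite mem_index_iota => /andP[iM]; apply: G0.
Qed.

(* [stair_labels a b] labels the universal character of two staircases with
   b - 1 and a - 1 steps, each partition being padded with one zero part, and
   [padded_labels a b] adds a second zero part on each side.  The former makes
   sense for a = 0 or b = 0, where it gives the character for a = 1 or b = 1. *)
Definition stair_labels (a b i : nat) : label :=
  if (i < a)%N then (false, i%:Z *+ 2)
  else (true, i%:Z *+ 2 - (a + b)%N%:Z + 1).

Definition padded_labels (a b i : nat) : label :=
  if i == 0%N then (false, 0) else if (i <= a)%N then (false, i%:Z *+ 2 - 1)
  else if (i <= a + b)%N then (true, i%:Z *+ 2 - (a + b)%N%:Z)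
  else (true, (a + b).+1%:Z).

(* The rows of [padded_labels a.+1 b.+1] for the largest part of the first and
   of the second partition, once this part is enlarged by 2. *)
Definition raised_label (a b : nat) : label := (true, a%:Z - b%:Z).

Definition lowered_label (a : nat) : label := (false, a%:Z *+ 2 + 3%:R).

Ltac label_arith :=
  rewrite /with_label /rotate_labels /label_shift /label_dual
    /padded_labels /stair_labels /raised_label /lowered_label /=;
  do ?case: ifP => ? /=; congr (_, _); lia.

Lemma dual_padded_labels a b i : (i < (a + b).+2)%N ->
  dual_labels (a + b).+2 (padded_labels a b) i = padded_labels b a i.
Proof. by move=> iM; rewrite /dual_labels; label_arith. Qed.

Lemma sum_padded_labels (V : nmodType) (G : nat -> label -> V) a b :
  \sum_(i < (a + b).+2) G i (padded_labels a b i) =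
  G 0%N (false, 0) + \sum_(i < a) G i.+1 (false, i%:Z *+ 2 + 1)
  + \sum_(i < b) G (a + i).+1 (true, i%:Z *+ 2 + (a%:Z - b%:Z + 2))
  + G (a + b).+1 (true, (a + b).+1%:Z).
Proof.
rewrite big_ord_recr big_ord_recl big_split_ord /= addrA; congr (_ + _ + _ + _).
- apply: eq_bigr => i _; have ia := ltn_ord i.
  by congr (G _ _); rewrite /bump; label_arith.
- apply: eq_bigr => i _; have ib := ltn_ord i.
  by congr (G _ _); rewrite /bump; label_arith.
by congr (G _ _); label_arith.
Qed.

Lemma nlabels_padded c a b :
  nlabels c (a + b).+2 (padded_labels a b) = (if c then b else a).+1.
Proof.
rewrite /nlabels (sum_padded_labels (fun _ l => (l.1 == c) : nat)) /=.
by rewrite !sum_nat_const !card_ord; case: c; rewrite /=; lia.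
Qed.

Lemma displacement_padded a b :
  displacement (a + b).+2 (padded_labels a b) = 'C(a, 2)%:Z - 'C(b, 2)%:Z.
Proof.
rewrite /displacement (sum_padded_labels (fun i l => l.2 - i%:Z)) /=.
rewrite !subrr add0r addr0 -!bin2_sum !big_mkord -!natz !natr_sum.
congr (_ + _).
  by apply: eq_bigr => i _; lia.
rewrite [in RHS](reindex_inj rev_ord_inj) -sumrN; apply: eq_bigr => i _ /=.
by have := ltn_ord i; lia.
Qed.

Lemma top_labels_padded a b : top_labels (a + b.+1) (padded_labels a b.+1).
Proof. by split; label_arith. Qed.

Section StaircaseDeterminants.
Variables (R : comNzRingType) (p q : int -> R).
Hypotheses (p_series : unit_series p) (q_series : unit_series q).
Local Notation det := (ldet p q).

Definition stairdet (a b : nat) : R := det (a + b) (stair_labels a b).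

Lemma ldet_padded a b : det (a + b).+2 (padded_labels a b) = stairdet a b.
Proof.
rewrite ldet_strip_top //; last by label_arith.
by rewrite ldet_strip_bot //; apply: ldet_ext => i iab; label_arith.
Qed.

Lemma stairdet1n b : stairdet 1 b = stairdet 0 b.
Proof.
by rewrite /stairdet ldet_strip_bot //; apply: ldet_ext => i _; label_arith.
Qed.

Lemma stairdetn1 a : stairdet a 1 = stairdet a 0.
Proof.
rewrite /stairdet addn1 ldet_strip_top ?addn0 //; last by label_arith.
by apply: ldet_ext => i ia; label_arith.
Qed.

Lemma stairdet_pred a b : stairdet a.-1.+1 b.-1.+1 = stairdet a b.
Proof. by case: a b => [|a] [|b]; rewrite /= ?stairdet1n ?stairdetn1. Qed.

Lemma stairdet_core a b : stairdet a.+1 b.+1 =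
  \det (\matrix_(i < a + b, j < a + b)
    if (i < a)%N then q (i%:Z *+ 2 + 1 - j%:Z)
    else p (j%:Z - (i%:Z *+ 2 - (a + b)%N%:Z))).
Proof.
rewrite /stairdet addSn ldet_strip_bot // addnS ldet_strip_top //; last first.
  by label_arith.
congr (\det _); apply/matrixP => i j; rewrite !mxE /lrow /stair_labels ltnS.
by case: (ltnP i a) => _ /=; [congr q | congr p]; lia.
Qed.

Section Neighbours.
Variables a b : nat.
Local Notation m := (a.+1 + b.+1)%N.
Local Notation L := (padded_labels a.+1 b.+1).
Local Notation raised := (raised_label a b).
Local Notation lowered := (lowered_label a).

Lemma ldet_padded_false_to_true :
  det m.+2 (with_label L a.+1 raised) = stairdet a b.+2.
Proof.
have sizeE : (a + b.+2)%N = m by lia.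
by rewrite -ldet_padded sizeE; apply: ldet_ext => i im; label_arith.
Qed.

Lemma ldet_padded_true_to_false :
  det m.+2 (with_label L a.+2 lowered) = stairdet a.+2 b.
Proof.
have sizeE : (a.+2 + b)%N = m by lia.
by rewrite -ldet_padded sizeE; apply: ldet_ext => i im; label_arith.
Qed.

Lemma ldet_padded_zero_to_true : det m.+2 (with_label L 0 raised) =
  (-1) ^+ a.+1 * stairdet a.+2 b.+2.
Proof.
have am : (0 + a.+1 < m.+2)%N by lia.
have sizeE : (a.+2 + b.+2)%N = m.+2 by lia.
rewrite -[LHS](signrMK a.+1) -(ldet_rotate _ _ _ am); congr (_ * _).
rewrite /stairdet sizeE ldet_strip_top //; last by label_arith.
by rewrite [RHS]ldet_strip_bot //; apply: ldet_ext => i im; label_arith.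
Qed.

Lemma ldet_padded_true_to_zero : det m.+2 (with_label L a.+2 (false, 2)) =
  (-1) ^+ a * stairdet a b.
Proof.
pose sorted i : label := if (i < 3)%N then (false, i%:Z) else
  if (i <= a.+2)%N then (false, i%:Z *+ 2 - 3%:R) else L i.
have am : (2 + a < m.+2)%N by lia.
transitivity (det m.+2 (rotate_labels 2 a sorted)).
  by apply: ldet_ext => i im; rewrite /sorted; label_arith.
rewrite ldet_rotate //; congr (_ * _).
have sizeE : m = (a + b).+2 by lia.
rewrite sizeE ldet_strip_top //; last by rewrite /sorted; label_arith.
do 3 rewrite ldet_strip_bot //.
by apply: ldet_ext => i im; rewrite /sorted; label_arith.
Qed.

Lemma ldet_padded_raise0 i : (i < m.+2)%N -> i \notin [:: a.+2; m.+1] ->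
  det m.+2 (with_label L i (label_shift (-2) (L i))) = 0.
Proof.
case: q_series => _ qN; rewrite !inE negb_or => im /andP[ia i1].
have [i_small|i_large] := leqP i 1.
  apply: ldet_zero_label => // j _; rewrite /lrow /label_shift /padded_labels.
  by case: i {im ia i1} i_small => [|[|i]] //= _; rewrite qN //; lia.
have -> : label_shift (-2) (L i) = L i.-1 by label_arith.
by apply: ldet_repeated_label; lia.
Qed.

Lemma ldet_raised_lower0 i : let Lr := with_label L a.+2 raised in
  (i < m.+2)%N -> i \notin [:: 0; a.+1; a.+2]%N ->
  det m.+2 (with_label Lr i (label_shift 2 (Lr i))) = 0.
Proof.
case: p_series => _ pN Lr; rewrite !inE !negb_or => im /and3P[i0 ia ia'].
have [i_large|i_small] := leqP m i.
  apply: ldet_zero_label => //.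
  have -> : Lr i = (true, i%:Z) by rewrite /Lr; label_arith.
  by move=> j jm; rewrite /lrow /= pN //; lia.
have -> : label_shift 2 (Lr i) = Lr i.+1 by rewrite /Lr; label_arith.
by apply: ldet_repeated_label; lia.
Qed.

End Neighbours.
End StaircaseDeterminants.

Lemma ldet_dual_padded (R : comNzRingType) (p q : int -> R) a b k l :
  (k < (a + b).+2)%N ->
  ldet q p (b + a).+2
    (with_label (padded_labels b a) k (label_dual (a + b).+2 l)) =
  ldet p q (a + b).+2 (with_label (padded_labels a b) ((a + b).+1 - k) l).
Proof.
move=> kM; rewrite [(b + a)%N]addnC -[RHS]ldet_dual; apply: ldet_ext => i iM.
rewrite dual_with_label ?ltnS ?leq_subr // /with_label dual_padded_labels //.
by rewrite subSS subKn.
Qed.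

Section RaisedStaircase.
Variables (F : fieldType) (X Y : int -> F) (a b : nat).
Hypothesis pcharF : has_pchar0 F.
Local Notation p := (complete X).
Local Notation q := (complete Y).
Local Notation m := (a.+1 + b.+1)%N.
Local Notation L := (padded_labels a.+1 b.+1).
Local Notation det := (ldet p q m.+2).
Local Notation raised := (raised_label a b).
Local Notation Lr := (with_label L a.+2 raised).
Local Notation Lz := (with_label L m.+1 (true, m.+1%:Z - 2)).

Let topL : top_labels m L. Proof. exact: top_labels_padded. Qed.
Let label_first : L a.+2 = (true, a%:Z - b%:Z + 2).
Proof. by label_arith. Qed.
Let raise_first : label_shift (-2) (L a.+2) = raised.
Proof. by label_arith. Qed.
Let raise_top : label_shift (-2) (L m.+1) = (true, m.+1%:Z - 2).
Proof. by case: topL => -> _. Qed.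
Let moved_uniq : uniq [:: a.+2; m.+1].
Proof. by rewrite /= inE andbT; lia. Qed.
Let moved_lt : all (fun k => k < m.+2)%N [:: a.+2; m.+1].
Proof. by rewrite /= andbT; lia. Qed.

Lemma ldet_raised_add_top : det Lr + det Lz = X 2 * det L.
Proof.
rewrite -(sum_ldet_shift2 X Y pcharF topL).
rewrite (sum_ord_supp
  (G := fun i => det (with_label L i (label_shift (-2) (L i))))
  moved_uniq moved_lt) => [|i iM im].
  by rewrite !big_cons big_nil addr0 raise_first raise_top.
by rewrite ldet_padded_raise0 //; apply: unit_series_complete.
Qed.

Lemma der_ldet_padded_raises (D : {derivation F}) :
  (forall k, Y k = X (- k)) -> raises X D ->
  D (det L) = b.*2.+1%:R * det Lr
  + ((displacement m.+2 L)%:~R - X 1 ^+ 2 / 2 - (b%:R + 2^-1) * X 2) * det L.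
Proof.
move=> YX DX; rewrite (der_ldet_raises pcharF YX DX topL).
rewrite (sum_ord_supp (G := fun i =>
    (_ - (L i).2%:~R - _ * ((L i).1 == false)%:R) *
    det (with_label L i (label_shift (-2) (L i)))) moved_uniq moved_lt)
  => [|i iM im].
  rewrite !big_cons big_nil addr0 raise_first raise_top nlabels_padded.
  rewrite (canRL (addKr _) ldet_raised_add_top) label_first.
  case: topL => -> _ /=; move: (det Lr) (det L) (displacement _ _) => r s d.
  by rewrite -muln2; field; apply: (pchar0_natf_neq0 (n := 2)).
by rewrite ldet_padded_raise0 ?mulr0 //; apply: unit_series_complete.
Qed.

End RaisedStaircase.

Section TodaEquations.
Variables (F : fieldType) (X Y : int -> F) (Dlow Dup : {derivation F}).
Hypothesis pcharF : has_pchar0 F.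
Hypothesis YX : forall k, Y k = X (- k).
Hypothesis DlowX : lowers X Dlow.
Hypothesis DupX : raises X Dup.
Local Notation p := (complete X).
Local Notation q := (complete Y).
Local Notation tau := (stairdet p q).

Let XY k : X k = Y (- k). Proof. by rewrite YX opprK. Qed.
Let DlowY : raises Y Dlow. Proof. exact: raises_opp YX DlowX. Qed.
Let p_series : unit_series p. Proof. exact: unit_series_complete. Qed.
Let q_series : unit_series q. Proof. exact: unit_series_complete. Qed.

Definition hirota (f : F) := f * Dlow (Dup f) - Dlow f * Dup f - 2 * f * Dup f.

Section Centre.
Variables a b : nat.
Local Notation m := (a.+1 + b.+1)%N.
Local Notation L := (padded_labels a.+1 b.+1).
Local Notation raised := (raised_label a b).
Local Notation lowered := (lowered_label a).
Local Notation Lr := (with_label L a.+2 raised).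
Local Notation det := (ldet p q m.+2).
Local Notation c := (displacement m.+2 L)%:~R.

Let tau_centre : det L = tau a.+1 b.+1. Proof. exact: ldet_padded. Qed.

Lemma Dup_ldet_centre : Dup (det L) = b.*2.+1%:R * det Lr
  + (c - X 1 ^+ 2 / 2 - (b%:R + 2^-1) * X 2) * det L.
Proof. exact: der_ldet_padded_raises. Qed.

Let dual_centre : ldet q p (b.+1 + a.+1).+2 (padded_labels b.+1 a.+1) = det L.
Proof.
rewrite [(b.+1 + _)%N]addnC -[RHS]ldet_dual; apply: ldet_ext => i iM.
by rewrite dual_padded_labels.
Qed.

Let dual_raised :
  ldet q p (b.+1 + a.+1).+2
    (with_label (padded_labels b.+1 a.+1) b.+2 (raised_label b a)) =
  det (with_label L a.+1 lowered).
Proof.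
have -> : raised_label b a = label_dual m.+2 lowered by label_arith.
by rewrite ldet_dual_padded; [congr (det (with_label _ _ _)); lia | lia].
Qed.

Lemma Dlow_ldet_centre : Dlow (det L) =
  a.*2.+1%:R * det (with_label L a.+1 lowered)
  + (- c - Y 1 ^+ 2 / 2 - (a%:R + 2^-1) * Y 2) * det L.
Proof.
have := der_ldet_padded_raises b a pcharF XY DlowY.
rewrite dual_centre dual_raised => ->.
by rewrite !displacement_padded -intrN opprB.
Qed.

Lemma ldet_lowered_add_zero :
  det (with_label L a.+1 lowered) + det (with_label L 0 (false, 2)) =
  Y 2 * det L.
Proof.
have := ldet_raised_add_top Y X b a pcharF.
rewrite dual_centre dual_raised => <-; congr (_ + _).
have -> : (true, (b.+1 + a.+1).+1%:Z - 2) = label_dual m.+2 (false, 2).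
  by label_arith.
by rewrite ldet_dual_padded; [congr (det (with_label _ _ _)); lia | lia].
Qed.

Let raised_bottom : bottom_labels Lr. Proof. by []. Qed.
Let lowered_uniq : uniq [:: 0; a.+1; a.+2]%N.
Proof. by rewrite /= !inE; lia. Qed.
Let lowered_lt : all (fun k => k < m.+2)%N [:: 0; a.+1; a.+2]%N.
Proof. by rewrite /=; lia. Qed.
Let label_last : Lr a.+1 = (false, a%:Z *+ 2 + 1).
Proof. by label_arith. Qed.
Let label_raised : Lr a.+2 = raised. Proof. by rewrite /with_label eqxx. Qed.
Let lower_last : label_shift 2 (Lr a.+1) = lowered.
Proof. by label_arith. Qed.
Let lower_raised : det (with_label Lr a.+2 (label_shift 2 (Lr a.+2))) = det L.
Proof.
apply: ldet_ext => i _; rewrite /with_label eqxx; case: eqP => // ->.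
by label_arith.
Qed.

Lemma ldet_raised_lowered_add_zero :
  det (with_label Lr a.+1 lowered) + det (with_label Lr 0 (false, 2)) + det L =
  Y 2 * det Lr.
Proof.
rewrite -(sum_ldet_shiftN2 X Y pcharF _ raised_bottom).
rewrite (sum_ord_supp
  (G := fun i => det (with_label Lr i (label_shift 2 (Lr i))))
  lowered_uniq lowered_lt) => [|i iM im]; last exact: ldet_raised_lower0.
rewrite !big_cons big_nil addr0 lower_last lower_raised.
by rewrite addrA [X in X + _]addrC.
Qed.

Lemma displacement_raised : displacement m.+2 Lr = displacement m.+2 L - 2.
Proof.
have aM : (a.+2 < m.+2)%N by lia.
rewrite /displacement (bigD1 (Ordinal aM)) // [in RHS](bigD1 (Ordinal aM)) //=.
rewrite label_raised [RHS]addrAC; congr (_ + _).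
  by rewrite /padded_labels; do ?case: ifP => ? /=; lia.
by apply: eq_bigr => i; rewrite /with_label -val_eqE /= => /negbTE->.
Qed.

Lemma nlabels_raised : nlabels true m.+2 Lr = b.+2.
Proof.
rewrite -(nlabels_padded true a.+1 b.+1); apply: eq_bigr => i _.
rewrite /with_label; case: (eqVneq (i : nat) a.+2) => // ->.
by rewrite /padded_labels; do ?case: ifP => ? //=; lia.
Qed.

Lemma Dlow_ldet_raised : Dlow (det Lr) =
  a.*2.+1%:R * det (with_label Lr a.+1 lowered) + (a%:R - b%:R - X 0) * det L
  + (2 - c - Y 1 ^+ 2 / 2 - (a%:R + 2^-1) * Y 2) * det Lr.
Proof.
rewrite (der_ldet_lowers pcharF YX _ DlowX raised_bottom).
rewrite (sum_ord_supp (G := fun i =>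
    (_ - (_ - (Lr i).2)%:~R - _ * ((Lr i).1 == true)%:R) *
    det (with_label Lr i (label_shift 2 (Lr i)))) lowered_uniq lowered_lt)
    => [|i iM im]; last by rewrite ldet_raised_lower0 ?mulr0.
rewrite !big_cons big_nil addr0 lower_last lower_raised label_last label_raised.
rewrite displacement_raised nlabels_raised.
have /(canRL (addrK _))/(canRL (addKr _))-> := ldet_raised_lowered_add_zero.
by rewrite /= -muln2; field; apply: (pchar0_natf_neq0 (n := 2)).
Qed.

Lemma plucker_lowered : det L * det (with_label Lr a.+1 lowered) =
  det Lr * det (with_label L a.+1 lowered) - tau a b.+2 * tau a.+2 b.
Proof.
rewrite ldet_plucker; try lia.
by rewrite ldet_padded_true_to_false // ldet_padded_false_to_true //; ring.
Qed.

Lemma plucker_zero : det L * det (with_label Lr 0 (false, 2)) =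
  det Lr * det (with_label L 0 (false, 2)) + tau a.+2 b.+2 * tau a b.
Proof.
rewrite ldet_plucker; try lia.
rewrite ldet_padded_true_to_zero // ldet_padded_zero_to_true // mulrACA.
by rewrite -exprD -signr_odd oddD /= addbN addbb expr1; ring.
Qed.

Lemma stairdet_plucker :
  tau a b.+2 * tau a.+2 b - tau a.+2 b.+2 * tau a b = tau a.+1 b.+1 ^+ 2.
Proof.
have /(canRL (addKr _)) LE := ldet_raised_lowered_add_zero.
rewrite -tau_centre expr2 [X in _ = _ * X]LE.
rewrite mulrDr mulrN mulrDr plucker_lowered plucker_zero.
by rewrite [det L * _]mulrCA mulrA -ldet_lowered_add_zero; ring.
Qed.

Lemma displacement_centre :
  (displacement m.+2 L)%:~R *+ 2 = (a%:R - b%:R) * (a%:R + b%:R + 1) :> F.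
Proof.
have bin2_double n : ('C(n.+1, 2))%:R *+ 2 = n%:R * (n%:R + 1) :> F.
  by rewrite -mulr_natr -natrM mulnC mul_bin_left bin1 subSS subn0; ring.
by rewrite displacement_padded intrB mulrnBl -!pmulrn !bin2_double; ring.
Qed.

Lemma hirota_stairdet_cross :
  hirota (tau a.+1 b.+1) =
  (X 1 * X (-1) - (a%:R - b%:R) ^+ 2) * tau a.+1 b.+1 ^+ 2
  - a.*2.+1%:R * b.*2.+1%:R * (tau a b.+2 * tau a.+2 b).
Proof.
have Dlow_coef : Dlow (c - X 1 ^+ 2 / 2 - (b%:R + 2^-1) * X 2) =
    X 1 * X (-1) - X 1 ^+ 2 - b.*2.+1%:R * (X 2 - X 0).
  have Dlow_X1 : Dlow (X 1) = X 1 - X (-1) by rewrite DlowX mul1r.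
  have Dlow_X2 : Dlow (X 2) = 2 * (X 2 - X 0) by rewrite DlowX.
  have Dlow_half : Dlow 2^-1 = 0 by rewrite derV der_nat oppr0 mul0r.
  rewrite !raddfB /= der_int !derM [Dlow (_ + _)]raddfD /= Dlow_half der_nat.
  by rewrite Dlow_X1 Dlow_X2 -muln2; field; apply: (pchar0_natf_neq0 (n := 2)).
rewrite -tau_centre /hirota Dup_ldet_centre raddfD /= !derM der_nat Dlow_coef.
rewrite Dlow_ldet_raised Dlow_ldet_centre.
have cE : c = (a%:R - b%:R) * (a%:R + b%:R + 1) / 2 :> F.
  apply: (canRL (mulfK _)); first exact: (pchar0_natf_neq0 (n := 2)).
  by rewrite mulr_natr displacement_centre.
have -> : tau a b.+2 * tau a.+2 b =
    det Lr * det (with_label L a.+1 lowered)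
    - det L * det (with_label Lr a.+1 lowered).
  by rewrite plucker_lowered; ring.
by rewrite cE -!muln2; field; apply: (pchar0_natf_neq0 (n := 2)).
Qed.

Lemma hirota_stairdet_diag :
  hirota (tau a.+1 b.+1) =
  (X 1 * X (-1) - (a%:R + b%:R + 1) ^+ 2) * tau a.+1 b.+1 ^+ 2
  - a.*2.+1%:R * b.*2.+1%:R * (tau a.+2 b.+2 * tau a b).
Proof.
have /(canRL (subrK _)) := stairdet_plucker.
by rewrite hirota_stairdet_cross => ->; rewrite -!muln2; ring.
Qed.

End Centre.
End TodaEquations.

Definition dfact_prod (u : nat) : nat :=
  \prod_(1 <= j < u.+1) dfact (2 * j - 1).

Lemma dfact_prodS u : dfact_prod u.+1 = (dfact_prod u * dfact (2 * u + 1))%N.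
Proof.
by rewrite /dfact_prod big_nat_recr //; congr (_ * dfact _)%N; lia.
Qed.

Lemma dfact_prod_gt0 u : (0 < dfact_prod u)%N.
Proof.
have dfact_gt0 n : (0 < dfact n)%N.
  have [k] := ubnP n; elim: k n => // k IH [|[|n]] // nk.
  by rewrite -[dfact _]/(n.+2 * dfact n)%N muln_gt0 /= IH //; lia.
by rewrite /dfact_prod prodn_cond_gt0.
Qed.

Lemma dfact_prod_neighbours u :
  (dfact_prod u.+1 * dfact_prod u.-1 = u.*2.+1 * dfact_prod u ^ 2)%N.
Proof.
case: u => [|u]; first by rewrite dfact_prodS /dfact_prod big_geq.
rewrite !dfact_prodS (_ : 2 * u.+1 + 1 = (2 * u + 1).+2)%N; last by lia.
by rewrite -[dfact _.+2]/((2 * u + 1).+2 * dfact (2 * u + 1))%N -muln2 /=; ring.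
Qed.

Definition triangle (v : nat) : nat := (v * v.+1) %/ 2.

Lemma triangle_double v : (triangle v * 2 = v * v.+1)%N.
Proof. by rewrite /triangle divnK // dvdn2 oddM /=; case: (odd v). Qed.

Lemma triangle_neighbours v :
  (triangle v.+1 + triangle v.-1 = (triangle v * 2).+1)%N.
Proof.
have := triangle_double v.+1; have := triangle_double v.-1.
by have := triangle_double v; case: v => [|v] /=; nia.
Qed.

Lemma ufun_reflect k : ufun (1 - k) = ufun k.
Proof. by rewrite /ufun; do ?case: ifP => ?; lia. Qed.

Lemma ufun_pos (k : int) : 0 < k ->
  [/\ ufun (k + 1) = (ufun k).+1, ufun (k - 1) = (ufun k).-1 &
      k = (ufun k)%:Z + 1].
Proof. by rewrite /ufun => k0; split; do ?case: ifP => ?; lia. Qed.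

Lemma ufun_nonpos (k : int) : (0 < k) = false ->
  [/\ ufun (k - 1) = (ufun k).+1, ufun (k + 1) = (ufun k).-1 &
      k = - (ufun k)%:Z].
Proof. by rewrite /ufun => k0; split; do ?case: ifP => ?; lia. Qed.

Section NormalisedTau.
Variables (F : fieldType) (X Y : int -> F).
Variables (Dlow Dup : {derivation F}) (w g : F).
Hypothesis pcharF : has_pchar0 F.
Hypothesis YX : forall k, Y k = X (- k).
Hypothesis DlowX : lowers X Dlow.
Hypothesis DupX : raises X Dup.
Hypothesis w_neq0 : w != 0.
Hypothesis Dup_w : Dup w = g * w.
Hypothesis Dlow_g : Dlow g = 2 * g.

Local Notation tau := (stairdet (complete X) (complete Y)).

Hypothesis tau_neq0 : forall a b, tau a.+1 b.+1 != 0.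

Let tau_pred a b : tau a.-1.+1 b.-1.+1 = tau a b.
Proof. by apply: stairdet_pred; apply: unit_series_complete. Qed.

Definition potential (f : F) : F :=
  Dlow (logder Dup f) - 2 * logder Dup f - X 1 * X (-1).

Definition toda_step (c : int) (f : F) : F :=
  w * (potential f + c%:~R ^+ 2) * f ^+ 2.

Definition stair_weight (u v : nat) : F :=
  (-1) ^+ triangle v * w ^+ triangle v * (dfact_prod u)%:R * (dfact_prod v)%:R.

Definition stair_tau (u v : nat) : F := stair_weight u v * tau v.+1 u.+1.

Lemma stair_weightE u v : stair_weight u v =
  (- w) ^+ triangle v * (dfact_prod u * dfact_prod v)%:R.
Proof. by rewrite /stair_weight -exprMn mulN1r -mulrA natrM. Qed.

Lemma dfact_prod_neq0 u v : (dfact_prod u * dfact_prod v)%:R != 0 :> F.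
Proof. by rewrite pchar0_natf_neq0 // muln_gt0 !dfact_prod_gt0. Qed.

Lemma stair_weight_neq0 u v : stair_weight u v != 0.
Proof.
by rewrite stair_weightE mulf_neq0 ?dfact_prod_neq0 // expf_neq0 // oppr_eq0.
Qed.

Lemma stair_tau_neq0 u v : stair_tau u v != 0.
Proof. by rewrite mulf_neq0 ?stair_weight_neq0. Qed.

Lemma stair_weight_diag u v : stair_weight u.+1 v.+1 * stair_weight u.-1 v.-1 =
  - w * u.*2.+1%:R * v.*2.+1%:R * stair_weight u v ^+ 2.
Proof.
have dfactE :
    (dfact_prod u.+1 * dfact_prod v.+1 * (dfact_prod u.-1 * dfact_prod v.-1)
    = u.*2.+1 * v.*2.+1 * (dfact_prod u * dfact_prod v) ^ 2)%N.
  by rewrite mulnACA !dfact_prod_neighbours; ring.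
rewrite !stair_weightE mulrACA -exprD triangle_neighbours -natrM dfactE.
by rewrite exprS exprM !natrM; ring.
Qed.

Lemma stair_weight_cross u v : stair_weight u.+1 v.-1 * stair_weight u.-1 v.+1 =
  - w * u.*2.+1%:R * v.*2.+1%:R * stair_weight u v ^+ 2.
Proof. by rewrite -stair_weight_diag !stair_weightE !natrM; ring. Qed.

Lemma logder_stair_weight u v :
  logder Dup (stair_weight u v) = (triangle v)%:R * g.
Proof.
have nw_neq0 : - w != 0 by rewrite oppr_eq0.
rewrite stair_weightE logderM ?expf_neq0 ?dfact_prod_neq0 // logderX //.
rewrite {2}/logder der_nat mul0r addr0 /logder raddfN /= Dup_w invrN mulrNN.
by rewrite mulfK.
Qed.

Lemma potential_weight u v f : f != 0 ->
  potential (stair_weight u v * f) = potential f.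
Proof.
move=> f0; rewrite /potential logderM ?stair_weight_neq0 // logder_stair_weight.
by rewrite raddfD /= derM der_nat Dlow_g; ring.
Qed.

Lemma potential_hirota f : f != 0 ->
  potential f * f ^+ 2 = hirota Dlow Dup f - X 1 * X (-1) * f ^+ 2.
Proof. by move=> f0; rewrite /potential /logder /hirota derM derV; field. Qed.

Lemma toda_step_weight c u v f : f != 0 ->
  toda_step c (stair_weight u v * f) = w * stair_weight u v ^+ 2 *
  (hirota Dlow Dup f - X 1 * X (-1) * f ^+ 2 + c%:~R ^+ 2 * f ^+ 2).
Proof.
by move=> f0; rewrite /toda_step potential_weight // -potential_hirota //; ring.
Qed.

Lemma toda_step_stair_diag u v (c : int) : c ^+ 2 = (u%:Z + v%:Z + 1) ^+ 2 ->
  toda_step c (stair_tau u v) = stair_tau u.+1 v.+1 * stair_tau u.-1 v.-1.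
Proof.
move=> cE; have c2 : c%:~R ^+ 2 = (v%:R + u%:R + 1) ^+ 2 :> F.
  by rewrite -rmorphXn cE /=; ring.
rewrite toda_step_weight // c2 (hirota_stairdet_diag pcharF YX DlowX DupX).
by rewrite /stair_tau [RHS]mulrACA stair_weight_diag tau_pred; ring.
Qed.

Lemma toda_step_stair_cross u v (c : int) : c ^+ 2 = (u%:Z - v%:Z) ^+ 2 ->
  toda_step c (stair_tau u v) = stair_tau u.+1 v.-1 * stair_tau u.-1 v.+1.
Proof.
move=> cE; have c2 : c%:~R ^+ 2 = (v%:R - u%:R) ^+ 2 :> F.
  by rewrite -rmorphXn cE /=; ring.
rewrite toda_step_weight // c2 (hirota_stairdet_cross pcharF YX DlowX DupX).
rewrite /stair_tau [RHS]mulrACA stair_weight_cross.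
by rewrite -(tau_pred v u.+2) -(tau_pred v.+2 u) /=; ring.
Qed.

Definition lattice_tau (k l : int) : F := stair_tau (ufun k) (ufun l).

Lemma toda_step_diag (k l : int) : toda_step (k + l - 1) (lattice_tau k l) =
  lattice_tau (k + 1) (l + 1) * lattice_tau (k - 1) (l - 1).
Proof.
rewrite /lattice_tau; case k0: (0 < k);
  [have [-> -> kE] := ufun_pos k0 | have [-> -> kE] := ufun_nonpos k0];
  (case l0: (0 < l);
   [have [-> -> lE] := ufun_pos l0 | have [-> -> lE] := ufun_nonpos l0]).
- by apply: toda_step_stair_diag; rewrite {1}kE {1}lE; ring.
- by apply: toda_step_stair_cross; rewrite {1}kE {1}lE; ring.
- rewrite [RHS]mulrC; apply: toda_step_stair_cross.
  by rewrite {1}kE {1}lE; ring.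
rewrite [RHS]mulrC; apply: toda_step_stair_diag.
by rewrite {1}kE {1}lE; ring.
Qed.

Lemma toda_step_cross (k l : int) : toda_step (l - k) (lattice_tau k l) =
  lattice_tau (k - 1) (l + 1) * lattice_tau (k + 1) (l - 1).
Proof.
have := toda_step_diag (1 - k) l; rewrite /lattice_tau ufun_reflect.
rewrite -(ufun_reflect (1 - k + 1)) -(ufun_reflect (1 - k - 1)).
have -> : 1 - k + l - 1 = l - k by ring.
have -> : 1 - (1 - k + 1) = k - 1 by ring.
by have -> : 1 - (1 - k - 1) = k + 1 by ring.
Qed.

End NormalisedTau.

Lemma eq_schurp (F : fieldType) (z z' : nat -> F) :
  z =1 z' -> schurp z =1 schurp z'.
Proof.
move=> zz' [k|k] //=; apply: eq_bigr => f _; apply: eq_bigr => j _.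
by rewrite zz'.
Qed.

Section UnicharStaircase.
Variables (F : fieldType) (X Y : int -> F) (x y : nat -> F).

Lemma unichar00 : unichar x y [::] [::] = 1.
Proof. exact: det_mx00. Qed.

Lemma unichar10 : unichar x y [:: 1%N] [::] = schurp x 1.
Proof. by rewrite /unichar det_mx11 mxE. Qed.

Lemma unichar01 : unichar x y [::] [:: 1%N] = schurp y 1.
Proof. by rewrite /unichar det_mx11 mxE. Qed.

Lemma nth_stair u k : (k < u)%N -> nth 0%N (stair u) k = (u - k)%N.
Proof. by move=> ku; rewrite nth_rev ?size_iota // nth_iota; lia. Qed.

Hypothesis xE : forall k : nat, x k = X k / k%:R.
Hypothesis yE : forall k : nat, y k = Y k / k%:R.

Lemma unichar_stair u v :
  unichar x y (stair u) (stair v) =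
  stairdet (complete X) (complete Y) v.+1 u.+1.
Proof.
rewrite stairdet_core; [|exact: unit_series_complete..].
rewrite /unichar (_ : size (stair u) = u); last by rewrite size_rev size_iota.
rewrite (_ : size (stair v) = v); last by rewrite size_rev size_iota.
congr (\det _); apply/matrixP => i j; rewrite !mxE /complete.
rewrite -(eq_schurp xE) -(eq_schurp yE); have im := ltn_ord i.
by case: ifP => iv; rewrite nth_stair; try congr schurp; lia.
Qed.

End UnicharStaircase.

Lemma null_fun_leibniz (R : pzRingType) (a b : R) :
  \0 (a * b) = \0 a * b + a * \0 b.
Proof. by rewrite /= mul0r mulr0 addr0. Qed.

HB.instance Definition _ (R : comNzRingType) :=
  isLeibniz.Build R (\0 : R -> R) (@null_fun_leibniz R).

Section ConstantPowerSums.
Variables (F : fieldType) (x : F).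
Hypothesis pcharF : has_pchar0 F.
Hypothesis x_not_int : forall z : int, x ^+ 2 != z%:~R ^+ 2.
Local Notation X := (fun _ : int => x).
Local Notation tau := (stairdet (complete X) (complete X)).
Local Notation D0 := (\0 : {derivation F}).

Lemma hirota_null_fun (f : F) : hirota D0 D0 f = 0.
Proof. by rewrite /hirota /= !mulr0 !subr0. Qed.

Lemma stairdet_const_neq0 a b : tau a.+1 b.+1 != 0.
Proof.
have D0_raises : raises X D0 by move=> k; rewrite /= subrr mulr0.
have D0_lowers : lowers X D0 by move=> k; rewrite /= subrr mulr0.
have factors (z : int) (y s s1 s2 : F) :
    0 = (x * x - z%:~R ^+ 2) * y ^+ 2 - s * (s1 * s2) ->
    y != 0 -> s1 != 0 /\ s2 != 0.
  move/esym/eqP; rewrite subr_eq0 => /eqP prodE y0.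
  have : s * (s1 * s2) != 0.
    by rewrite -prodE -expr2 mulf_neq0 ?expf_neq0 // subr_eq0.
  by rewrite !mulf_eq0 !negb_or => /and3P[].
have diag c e : tau c.+1 e.+1 != 0 -> tau c.+2 e.+2 != 0.
  have := hirota_stairdet_diag pcharF (fun=> erefl) D0_lowers D0_raises c e.
  rewrite (_ : c%:R + e%:R + 1 = (c%:Z + e%:Z + 1)%:~R :> F); last by ring.
  by rewrite hirota_null_fun => /factors fact /fact[].
have cross c e : tau c.+1 e.+1 != 0 -> tau c e.+2 != 0 /\ tau c.+2 e != 0.
  have := hirota_stairdet_cross pcharF (fun=> erefl) D0_lowers D0_raises c e.
  rewrite (_ : c%:R - e%:R = (c%:Z - e%:Z)%:~R :> F); last by ring.
  by rewrite hirota_null_fun => /factors.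
have seriesX : unit_series (complete X) := unit_series_complete X.
have first_row e : tau 1 e.+1 != 0.
  elim: e => [|e /cross[]]; last by rewrite -stairdet1n.
  by rewrite stairdet_core // det_mx00 oner_neq0.
have first_column c : tau c.+1 1 != 0.
  by elim: c => [|c /cross[_]]; [exact: first_row | rewrite -stairdetn1].
by elim: a b => [|a IH] [|b] //; apply: diag.
Qed.

End ConstantPowerSums.

(** * Fields of fractions *)

Section QuotientRule.
Variables (F : fieldType) (a b a' b' da db da' db' : F).
Hypotheses (b0 : b != 0) (b0' : b' != 0).

Lemma quotient_rule_add :
  ((da * b' + a * db' + (da' * b + a' * db)) * (b * b')
   - (a * b' + a' * b) * (db * b' + b * db')) / (b * b') ^+ 2 =
  (da * b - a * db) / b ^+ 2 + (da' * b' - a' * db') / b' ^+ 2.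
Proof. by field; rewrite b0 b0'. Qed.

Lemma quotient_rule_mul :
  ((da * a' + a * da') * (b * b') - (a * a') * (db * b' + b * db'))
  / (b * b') ^+ 2 =
  (da * b - a * db) / b ^+ 2 * (a' / b')
  + a / b * ((da' * b' - a' * db') / b' ^+ 2).
Proof. by field; rewrite b0 b0'. Qed.

End QuotientRule.

Local Notation "x %:F" := (FracField.tofrac x).

Section FractionDerivation.
Variables (R : idomainType) (d : {derivation R}).

Definition fracder (f : {fraction R}) : {fraction R} :=
  let r := repr f in
  (d (frac r).1 * (frac r).2 - (frac r).1 * d (frac r).2)%:F
  / ((frac r).2 ^+ 2)%:F.

Lemma fracE (f : {fraction R}) :
  f = (frac (repr f)).1%:F / (frac (repr f)).2%:F.
Proof.
have d0 : (frac (repr f)).2%:F != 0 by rewrite tofrac_eq0 denom_ratioP.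
apply: (canRL (mulfK d0)).
rewrite -{1}[f]reprK; unlock FracField.tofrac; rewrite -[LHS]FracField.pi_mul.
apply/eqmodP; rewrite /= FracField.equivfE /FracField.mulf.
by rewrite !numden_Ratio ?mulr1 ?oner_neq0 ?denom_ratioP // mulrC.
Qed.

Lemma fraction_quotP (f : {fraction R}) : exists a b, b != 0 /\ f = a%:F / b%:F.
Proof.
by exists (frac (repr f)).1, (frac (repr f)).2; rewrite denom_ratioP -fracE.
Qed.

Lemma fracder_quot a b : b != 0 ->
  fracder (a%:F / b%:F) = (d a * b - a * d b)%:F / (b ^+ 2)%:F.
Proof.
move=> b0; rewrite /fracder; set f := a%:F / b%:F.
have := fracE f; have := @denom_ratioP _ (repr f).
move: (frac (repr f)).1 (frac (repr f)).2 => n e e0 fE.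
have [bF eF] : b%:F != 0 /\ e%:F != 0 by rewrite !tofrac_eq0.
have cross : a * e = n * b.
  apply/eqP; rewrite -tofrac_eq !tofracM; apply/eqP.
  by move/eqP: fE; rewrite /f eqr_div // => /eqP.
have dcross : d a * e + a * d e = d n * b + n * d b by rewrite -!derM cross.
apply/eqP; rewrite eqr_div ?tofrac_eq0 ?expf_neq0 // -!tofracM tofrac_eq.
apply/eqP.
have -> : (d n * e - n * d e) * b ^+ 2 =
  (d n * b + n * d b) * (e * b) - (n * b) * (d b * e + b * d e) by ring.
by rewrite -dcross -cross; ring.
Qed.

Lemma fracder_nmod_morphism : nmod_morphism fracder.
Proof.
split=> [|f h].
  have {1}-> : 0 = (0%:F / 1%:F : {fraction R}) by rewrite tofrac0 mul0r.
  by rewrite fracder_quot ?oner_neq0 // raddf0 !mul0r subrr tofrac0 mul0r.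
have [a [b [b0 ->]]] := fraction_quotP f.
have [a' [b' [b0' ->]]] := fraction_quotP h.
have [bF bF'] : b%:F != 0 /\ b'%:F != 0 by rewrite !tofrac_eq0.
rewrite addf_div // -!tofracM -tofracD !fracder_quot ?mulf_neq0 //.
rewrite (raddfD d) /= !derM !(tofracD, tofracN, tofracM, tofracXn).
exact: quotient_rule_add.
Qed.

Lemma fracder_leibniz f h : fracder (f * h) = fracder f * h + f * fracder h.
Proof.
have [a [b [b0 ->]]] := fraction_quotP f.
have [a' [b' [b0' ->]]] := fraction_quotP h.
have [bF bF'] : b%:F != 0 /\ b'%:F != 0 by rewrite !tofrac_eq0.
rewrite mulf_div -!tofracM !fracder_quot ?mulf_neq0 // !derM.
rewrite !(tofracD, tofracN, tofracM, tofracXn).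
exact: quotient_rule_mul.
Qed.

HB.instance Definition _ := GRing.isNmodMorphism.Build
  {fraction R} {fraction R} fracder fracder_nmod_morphism.
HB.instance Definition _ :=
  isLeibniz.Build {fraction R} fracder fracder_leibniz.

Lemma fracder_tofrac a : fracder a%:F = (d a)%:F.
Proof.
rewrite -[a%:F]divr1 -tofrac1 fracder_quot ?oner_neq0 // der1 mulr0 subr0 mulr1.
by rewrite expr1n tofrac1 divr1.
Qed.

End FractionDerivation.

Section Specialisation.
Variables (R : idomainType) (F : fieldType) (phi : {rmorphism R -> F}).

Definition specialises (f : {fraction R}) (c : F) :=
  exists a b, [/\ phi b != 0, f = a%:F / b%:F & c = phi a / phi b].

Lemma specialises_denom (b : R) : phi b != 0 -> b%:F != 0.
Proof.
by move=> pb; rewrite tofrac_eq0; apply: contraNneq pb => ->; rewrite rmorph0.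
Qed.

Lemma specialises_tofrac a : specialises a%:F (phi a).
Proof. by exists a, 1; rewrite rmorph1 tofrac1 !divr1 oner_neq0. Qed.

Lemma specialises0 : specialises 0 0.
Proof. by have := specialises_tofrac 0; rewrite tofrac0 rmorph0. Qed.

Lemma specialises1 : specialises 1 1.
Proof. by have := specialises_tofrac 1; rewrite tofrac1 rmorph1. Qed.

Lemma specialises_nat n : specialises n%:R n%:R.
Proof. by have := specialises_tofrac n%:R; rewrite !rmorph_nat. Qed.

Lemma specialisesD f g c e :
  specialises f c -> specialises g e -> specialises (f + g) (c + e).
Proof.
move=> [a [b [b0 -> ->]]] [a' [b' [b0' -> ->]]].
have bF := specialises_denom b0; have bF' := specialises_denom b0'.
exists (a * b' + a' * b), (b * b').
rewrite !addf_div // -!tofracM -tofracD -!rmorphM -rmorphD /=.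
by rewrite rmorphM mulf_neq0.
Qed.

Lemma specialisesM f g c e :
  specialises f c -> specialises g e -> specialises (f * g) (c * e).
Proof.
move=> [a [b [b0 -> ->]]] [a' [b' [b0' -> ->]]].
exists (a * a'), (b * b').
by rewrite !mulf_div -!tofracM -!rmorphM /= rmorphM mulf_neq0.
Qed.

Lemma specialisesN f c : specialises f c -> specialises (- f) (- c).
Proof.
move=> [a [b [b0 -> ->]]]; exists (- a), b.
by rewrite !rmorphN /= !mulNr.
Qed.

Lemma specialisesV f c : c != 0 -> specialises f c -> specialises f^-1 c^-1.
Proof.
move=> c0 [a [b [b0 -> cE]]]; exists b, a; rewrite cE !invf_div; split=> //.
by apply: contraNneq c0 => pa; rewrite cE pa mul0r.
Qed.

Lemma specialises_sum (I : Type) (r : seq I) (P : pred I) f c :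
  (forall i, P i -> specialises (f i) (c i)) ->
  specialises (\sum_(i <- r | P i) f i) (\sum_(i <- r | P i) c i).
Proof.
move=> fc; apply: (big_ind2 specialises) => //; first exact: specialises0.
by move=> *; apply: specialisesD.
Qed.

Lemma specialises_prod (I : Type) (r : seq I) (P : pred I) f c :
  (forall i, P i -> specialises (f i) (c i)) ->
  specialises (\prod_(i <- r | P i) f i) (\prod_(i <- r | P i) c i).
Proof.
move=> fc; apply: (big_ind2 specialises) => //; first exact: specialises1.
by move=> *; apply: specialisesM.
Qed.

Lemma specialisesX f c n : specialises f c -> specialises (f ^+ n) (c ^+ n).
Proof.
move=> fc; elim: n => [|n IH]; first by rewrite !expr0; apply: specialises1.
by rewrite !exprS; apply: specialisesM.
Qed.

Lemma specialises_neq0 f c : specialises f c -> c != 0 -> f != 0.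
Proof.
move=> [a [b [b0 -> ->]]] c0.
rewrite mulf_neq0 ?invr_neq0 ?specialises_denom //.
by apply: contraNneq c0 => ->; rewrite mul0r.
Qed.

Hypothesis pcharF : has_pchar0 F.

Lemma specialises_div_nat f c n : (0 < n)%N ->
  specialises f c -> specialises (f / n%:R) (c / n%:R).
Proof.
move=> n0 fc; apply: specialisesM => //; apply: specialisesV.
  exact: pchar0_natf_neq0.
exact: specialises_nat.
Qed.

Lemma specialises_schurp (x : nat -> {fraction R}) (x' : nat -> F) k :
  (forall j, specialises (x j.+1) (x' j.+1)) ->
  specialises (schurp x k) (schurp x' k).
Proof.
move=> xx'; case: k => [k|k]; last exact: specialises0.
apply: specialises_sum => e _; apply: specialises_prod => j _.
by apply: specialises_div_nat; [exact: fact_gt0 | exact: specialisesX].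
Qed.

Lemma specialises_unichar (x y : nat -> {fraction R}) (x' y' : nat -> F)
    lam mu :
  (forall j, specialises (x j.+1) (x' j.+1)) ->
  (forall j, specialises (y j.+1) (y' j.+1)) ->
  specialises (unichar x y lam mu) (unichar x' y' lam mu).
Proof.
move=> xx' yy'; apply: specialises_sum => s _.
apply: specialisesM; first by apply/specialisesX/specialisesN/specialises1.
apply: specialises_prod => i _.
by rewrite !mxE; case: ifP => _; apply: specialises_schurp.
Qed.

End Specialisation.

(** * The Garnier vector fields and the polynomials T_{m,n} *)

Section DerivationCombination.
Variables (R : comPzRingType) (I : finType).
Variables (c : I -> R) (d : I -> {derivation R}).

Definition der_comb (f : R) : R := \sum_i c i * d i f.

Lemma der_comb_nmod_morphism : nmod_morphism der_comb.
Proof.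
split=> [|f g]; first by apply: big1 => i _; rewrite raddf0 mulr0.
by rewrite -big_split; apply: eq_bigr => i _; rewrite raddfD mulrDr.
Qed.

Lemma der_comb_leibniz f g : der_comb (f * g) = der_comb f * g + f * der_comb g.
Proof.
rewrite mulr_suml mulr_sumr -big_split; apply: eq_bigr => i _ /=.
by rewrite derM; ring.
Qed.

HB.instance Definition _ :=
  GRing.isNmodMorphism.Build R R der_comb der_comb_nmod_morphism.
HB.instance Definition _ := isLeibniz.Build R der_comb der_comb_leibniz.

End DerivationCombination.

Section GarnierVectorFields.
Variables (F : fieldType) (N : nat) (t th : 'I_N -> F) (kap : F).
Variable d : 'I_N -> {derivation F}.
Hypothesis pcharF : has_pchar0 F.
Hypothesis t_neq0 : forall i, t i != 0.
Hypothesis dt : forall i j, d i (t j) = (i == j)%:R.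
Hypothesis dth : forall i j, d i (th j) = 0.
Hypothesis dkap : forall i, d i kap = 0.

Definition powersum (k : int) : F := - kap + \sum_i th i * t i ^ k.

Definition lowering_field : {derivation F} :=
  der_comb (fun i => (t i ^+ 2 - 1) / t i) d.

Definition raising_field : {derivation F} :=
  der_comb (fun i => t i * (t i ^+ 2 - 1)) d.

Lemma der_comb_coordinate c i : der_comb c d (t i) = c i.
Proof.
rewrite /der_comb (bigD1 i) //= big1 => [|j /negbTE ji].
  by rewrite dt eqxx mulr1 addr0.
by rewrite dt ji mulr0.
Qed.

Lemma der_comb_powersum c (k : int) :
  der_comb c d (powersum k) = k%:~R * \sum_i c i * th i * (t i ^ k / t i).
Proof.
rewrite mulr_sumr; apply: eq_bigr => i _.
have -> : d i (powersum k) = k%:~R * (th i * (t i ^ k / t i)); last first.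
  by rewrite mulrCA !mulrA.
rewrite raddfD raddfN /= dkap oppr0 add0r raddf_sum.
rewrite (bigD1 i) //= big1 => [|j ji].
  by rewrite derM dth mul0r add0r der_exprz // dt eqxx mulr1 addr0 mulrCA.
by rewrite derM dth mul0r add0r der_exprz // dt eq_sym (negbTE ji) !mulr0.
Qed.

Lemma powersumB (k l : int) :
  powersum k - powersum l = \sum_i th i * (t i ^ k - t i ^ l).
Proof.
rewrite /powersum opprD addrACA subrr add0r -sumrB.
by apply: eq_bigr => i _; rewrite mulrBr.
Qed.

Lemma lowering_field_lowers : lowers powersum lowering_field.
Proof.
move=> k; rewrite powersumB [LHS]der_comb_powersum; congr (_ * _).
apply: eq_bigr => i _; have ti0 := t_neq0 i.
rewrite expfzDr // (_ : t i ^ (-2) = (t i ^+ 2)^-1) //.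
by move: (t i ^ k) => z; field.
Qed.

Lemma raising_field_raises : raises powersum raising_field.
Proof.
move=> k; rewrite powersumB [LHS]der_comb_powersum; congr (_ * _).
apply: eq_bigr => i _; have ti0 := t_neq0 i.
rewrite expfzDr // (_ : t i ^ 2 = t i ^+ 2) //.
by move: (t i ^ k) => z; field.
Qed.

Lemma raising_field_prod :
  raising_field (\prod_i t i) = (\sum_i (t i ^+ 2 - 1)) * \prod_i t i.
Proof.
apply: (big_ind2 (fun s r => raising_field r = s * r)) => [|s r s' r' h h'|i _].
- by rewrite der1 mul0r.
- by rewrite derM h h'; ring.
by rewrite [LHS]der_comb_coordinate mulrC.
Qed.

Lemma lowering_field_sum_sqr :
  lowering_field (\sum_i (t i ^+ 2 - 1)) = 2 * \sum_i (t i ^+ 2 - 1).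
Proof.
rewrite raddf_sum mulr_sumr; apply: eq_bigr => i _.
have dti : lowering_field (t i) = (t i ^+ 2 - 1) / t i.
  exact: der_comb_coordinate.
by rewrite raddfB /= der1 derX dti; have ti0 := t_neq0 i; field.
Qed.

Lemma powersum_product :
  kap * \sum_i th i * (t i ^+ 2 + 1) / t i
  - 2^-1 * \sum_i \sum_j th i * th j * (t i ^+ 2 + t j ^+ 2) / (t i * t j)
  - kap ^+ 2 = - (powersum 1 * powersum (-1)).
Proof.
pose a := \sum_i th i * t i; pose b := \sum_i th i / t i.
have -> : \sum_i th i * (t i ^+ 2 + 1) / t i = a + b.
  by rewrite -big_split; apply: eq_bigr => i _ /=; have ti0 := t_neq0 i; field.
have -> : \sum_i \sum_j th i * th j * (t i ^+ 2 + t j ^+ 2) / (t i * t j) =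
    2 * (a * b).
  transitivity (a * b + b * a); last by ring.
  rewrite {1}/a {2}/b !mulr_suml -big_split; apply: eq_bigr => i _ /=.
  rewrite !mulr_sumr -big_split; apply: eq_bigr => j _ /=.
  by have ti0 := t_neq0 i; have tj0 := t_neq0 j; field; rewrite ti0 tj0.
have -> : powersum 1 = - kap + a.
  by congr (_ + _); apply: eq_bigr => i _; rewrite expr1z.
have -> : powersum (-1) = - kap + b.
  by congr (_ + _); apply: eq_bigr => i _; rewrite exprN1.
by field; apply: (pchar0_natf_neq0 (n := 2)).
Qed.

End GarnierVectorFields.

HB.instance Definition _ n (R : comNzRingType) (i : 'I_n) :=
  isLeibniz.Build {mpoly R[n]} (mderiv i) (mderivM i).

HB.instance Definition _ N (i : 'I_N) :=
  Derivation.copy (@dfrac N i) (fracder (mderiv (inord i))).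

Lemma half_sqr_neq_int (z : int) : (- 2^-1) ^+ 2 != z%:~R ^+ 2 :> rat.
Proof.
rewrite sqrrN; apply/eqP => half2.
have : (z ^+ 2 * 4)%:~R = 1%:~R :> rat by rewrite intrM rmorphXn /= -half2.
by move/eqP; rewrite eqr_int => /eqP; lia.
Qed.

Lemma pchar0_fraction (R : idomainType) :
  has_pchar0 R -> has_pchar0 {fraction R}.
Proof.
move=> /pcharf0P pcharR; apply/pcharf0P => n.
by rewrite -(rmorph_nat (@FracField.tofrac R)) tofrac_eq0.
Qed.

Lemma pchar0_mpoly n (R : idomainType) :
  has_pchar0 R -> has_pchar0 {mpoly R[n]}.
Proof.
move=> /pcharf0P pcharR; apply/pcharf0P => k.
by rewrite -mpolyC_nat mpolyC_eq0.
Qed.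

Section Garnier.
Variable N : nat.
Local Notation V := N.*2.+1.
Local Notation P := {mpoly rat[V]}.
Local Notation K := {fraction P}.
Local Notation t := (@tvar N).
Local Notation th := (@theta N).
Local Notation kap := (kinf N).

Lemma dfrac_X (i : 'I_N) (k : nat) : (k < V)%N ->
  dfrac i ('X_(inord k) : P)%:F = (i == k :> nat)%:R.
Proof.
move=> kV; rewrite [LHS](fracder_tofrac (mderiv (inord i))) /= mderivX mnm1E.
rewrite -val_eqE /= !inordK //; last by have := ltn_ord i; lia.
rewrite eq_sym; case: eqP => [e|_]; last by rewrite scale0r tofrac0.
rewrite scale1r (_ : (_ - _)%MM = 0%MM) ?mpolyX0 ?tofrac1 //.
by apply/mnmP => l; rewrite mnmBE e subnn mnm0E.
Qed.

Lemma dfrac_tvar i j : dfrac i (t j) = (i == j)%:R.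
Proof. by rewrite dfrac_X //; have := ltn_ord j; lia. Qed.

Lemma dfrac_theta i j : dfrac i (th j) = 0.
Proof.
have ? := ltn_ord i; have ? := ltn_ord j.
by rewrite dfrac_X ?ltn_eqF //; lia.
Qed.

Lemma dfrac_kinf i : dfrac i kap = 0.
Proof. by rewrite dfrac_X ?ltn_eqF //; lia. Qed.

Lemma tvar_neq0 i : t i != 0.
Proof.
rewrite tofrac_eq0; apply/eqP => /(congr1 (mcoeff U_(inord i))%MM)/eqP.
by rewrite mcoeffX eqxx mcoeff0 oner_eq0.
Qed.

Lemma prod_tvar_neq0 : \prod_(i < N) t i != 0.
Proof. by apply/prodf_neq0 => i _; apply: tvar_neq0. Qed.

Let pchar_K : has_pchar0 K.
Proof. exact/pchar0_fraction/pchar0_mpoly/pchar_num. Qed.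

Local Notation X := (powersum t th kap).
Local Notation Y := (fun k => X (- k)).
Local Notation Dlow := (lowering_field t (@dfrac N)).
Local Notation Dup := (raising_field t (@dfrac N)).

Lemma Phi_potential (T : K) : Phi T = potential X Dlow Dup T.
Proof.
rewrite /Phi /potential.
have -> : \sum_(i < N) t i * (t i ^+ 2 - 1) * (dfrac i T / T) = logder Dup T.
  transitivity ((\sum_(i < N) t i * (t i ^+ 2 - 1) * dfrac i T) / T) => //.
  by rewrite mulr_suml; apply: eq_bigr => i _; rewrite mulrA.
have := powersum_product th kap pchar_K tvar_neq0.
set A := kap * _; set B := 2^-1 * _; set G := _ - 2 * _ => <-.
by rewrite !addrA.
Qed.

Lemma step_toda_step c (T : K) :
  step c T = toda_step X Dlow Dup (\prod_(i < N) t i) c T.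
Proof. by rewrite /step Phi_potential. Qed.

(* At this point every power sum X_k takes the value - 1 / 2, whose square is
   not that of an integer. *)
Definition base_point (i : 'I_V) : rat :=
  if (i < N)%N then 1 else if (i == N :> nat)%N then 2^-1 else 0.

Local Notation spec := (specialises (meval base_point)).

Lemma specialises_X (k : nat) : (k < V)%N ->
  spec ('X_(inord k) : P)%:F
    (if (k < N)%N then 1 else if k == N then 2^-1 else 0).
Proof.
move=> kV; have := specialises_tofrac (meval base_point) ('X_(inord k) : P).
by rewrite /= mevalXU /base_point inordK.
Qed.

Lemma specialises_tvar i : spec (t i) 1.
Proof.
by have ? := ltn_ord i; have := @specialises_X i; rewrite ltn_ord; apply; lia.
Qed.

Lemma specialises_kinf : spec kap 2^-1.
Proof. by have := @specialises_X N; rewrite ltnn eqxx; apply; lia. Qed.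

Lemma specialises_theta i : spec (th i) 0.
Proof.
have ? := ltn_ord i; have := @specialises_X (N.+1 + i).
by rewrite !ifF; try lia; apply; lia.
Qed.

Lemma specialises_powersum (s : 'I_N -> K) k :
  (forall i, spec (s i) 1) ->
  spec ((- kap + \sum_i th i * s i) / k.+1%:R) (- 2^-1 / k.+1%:R).
Proof.
move=> s1; apply: specialises_div_nat => //; first exact: pchar_num.
rewrite -[- 2^-1]addr0; apply: specialisesD.
  exact/specialisesN/specialises_kinf.
have <- : \sum_(i < N) 0 * 1 = 0 :> rat.
  by rewrite big1 // => i _; rewrite mul0r.
apply: specialises_sum => i _; apply: specialisesM => //.
exact: specialises_theta.
Qed.

Lemma specialises_xs k : spec (xs N k.+1) (- 2^-1 / k.+1%:R).
Proof.
apply: specialises_powersum => i.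
by rewrite -(expr1n _ k.+1); apply/specialisesX/specialises_tvar.
Qed.

Lemma specialises_ys k : spec (ys N k.+1) (- 2^-1 / k.+1%:R).
Proof.
apply: specialises_powersum => i; rewrite -(expr1n _ k.+1) -invr1.
by apply/specialisesX/specialisesV/specialises_tvar; apply: oner_neq0.
Qed.

Lemma xsE k : xs N k = X k / k%:R.
Proof. by []. Qed.

Lemma ysE k : ys N k = Y k / k%:R.
Proof.
rewrite /ys /powersum; congr ((_ + _) / _); apply: eq_bigr => i _.
by rewrite exprVn exprnN.
Qed.

Local Notation tau := (stairdet (complete X) (complete Y)).

Lemma tau_neq0 a b : tau a.+1 b.+1 != 0.
Proof.
rewrite -(unichar_stair xsE ysE b a).
pose c k : rat := - 2^-1 / k%:R.
have := specialises_unichar (pchar_num rat) (x' := c) (y' := c)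
  (stair b) (stair a) specialises_xs specialises_ys.
move=> /specialises_neq0; apply.
rewrite (@unichar_stair _ (fun=> - 2^-1) (fun=> - 2^-1)) //.
exact: stairdet_const_neq0 (pchar_num rat) half_sqr_neq_int _ _.
Qed.

Local Notation z := (lattice_tau X Y (\prod_(i < N) t i)).

Lemma lattice_tau_neq0 k l : z k l != 0.
Proof. exact: (stair_tau_neq0 pchar_K prod_tvar_neq0 tau_neq0). Qed.

Let Dlow_lowers : lowers X Dlow.
Proof.
exact: lowering_field_lowers tvar_neq0 dfrac_tvar dfrac_theta dfrac_kinf.
Qed.

Let Dup_raises : raises X Dup.
Proof.
exact: raising_field_raises tvar_neq0 dfrac_tvar dfrac_theta dfrac_kinf.
Qed.

Lemma step_diag (k l : int) :
  step (k + l - 1) (z k l) = z (k + 1) (l + 1) * z (k - 1) (l - 1).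
Proof.
rewrite step_toda_step.
exact: (toda_step_diag pchar_K (fun=> erefl) Dlow_lowers Dup_raises
  prod_tvar_neq0 (raising_field_prod dfrac_tvar)
  (lowering_field_sum_sqr tvar_neq0 dfrac_tvar) tau_neq0).
Qed.

Lemma step_cross (k l : int) :
  step (l - k) (z k l) = z (k - 1) (l + 1) * z (k + 1) (l - 1).
Proof.
rewrite step_toda_step.
exact: (toda_step_cross pchar_K (fun=> erefl) Dlow_lowers Dup_raises
  prod_tvar_neq0 (raising_field_prod dfrac_tvar)
  (lowering_field_sum_sqr tvar_neq0 dfrac_tvar) tau_neq0).
Qed.

Lemma bseq_unique (G : int -> K -> K) (y : int -> K) : (forall j, y j != 0) ->
  (forall j, G j (y j) = y (j + 1) * y (j - 1)) ->
  forall j, Defs.bseq G (y 0) (y 1) j = y j.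
Proof.
move=> y0 Gy.
have fwdE k : fwd G (y 0) (y 1) k = (y k%:Z, y k.+1%:Z).
  elim: k => [|k IH] //=; rewrite IH /= Gy; congr (_, _).
  have -> : k.+1%:Z + 1 = k.+2%:Z by lia.
  have -> : k.+1%:Z - 1 = k%:Z by lia.
  exact: (mulfK (y0 _)).
have bwdE k : bwd G (y 0) (y 1) k = (y (- k%:Z), y (1 - k%:Z)).
  elim: k => [|k IH] //=; rewrite IH /= Gy; congr (_, _).
    have -> : - k%:Z + 1 = 1 - k%:Z by lia.
    have -> : - k%:Z - 1 = - k.+1%:Z by lia.
    exact: (etrans (mulrC _ _) (mulKf (y0 _) _)).
  by congr y; lia.
by case=> k; rewrite /Defs.bseq ?fwdE // bwdE NegzE.
Qed.

Lemma lattice_tau_unichar k l : z k l =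
  stair_weight (\prod_(i < N) t i) (ufun k) (ufun l) *
  unichar (xs N) (ys N) (stair (ufun k)) (stair (ufun l)).
Proof. by rewrite (unichar_stair xsE ysE). Qed.

Let dfact_prod0 : dfact_prod 0 = 1%N.
Proof. by rewrite /dfact_prod big_geq. Qed.

Let dfact_prod1 : dfact_prod 1 = 1%N.
Proof. by rewrite dfact_prodS dfact_prod0. Qed.

Lemma lattice_tau_trivial k l : ufun k = 0%N -> ufun l = 0%N -> z k l = 1.
Proof.
move=> k0 l0; rewrite lattice_tau_unichar k0 l0 unichar00 /stair_weight.
by rewrite dfact_prod0 !expr0 !mulr1.
Qed.

Lemma lattice_tau_T10 : z (-1) 1 = T10 N.
Proof.
rewrite lattice_tau_unichar (_ : ufun (-1) = 1%N) // (_ : ufun 1 = 0%N) //.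
rewrite unichar10 /stair_weight dfact_prod0 dfact_prod1 !expr0 !mulr1 mul1r.
rewrite (eq_schurp xsE) -[schurp _ _]/(complete X 1) (complete1 _ pchar_K).
by rewrite /powersum addrC.
Qed.

Lemma lattice_tau_T11 : z 0 2 = T11 N.
Proof.
rewrite lattice_tau_unichar (_ : ufun 0 = 0%N) // (_ : ufun 2 = 1%N) //.
rewrite unichar01 /stair_weight dfact_prod0 dfact_prod1.
rewrite (_ : triangle 1 = 1%N) // !expr1 !mulr1 mulN1r (eq_schurp ysE).
rewrite -[schurp _ _]/(complete Y 1) (complete1 _ pchar_K).
by rewrite /T11 mulNr -mulrN /powersum opprD opprK.
Qed.

Lemma Tcol0_lattice_tau m : Tcol0 N m = z (- m) m.
Proof.
pose y (j : int) := z (- j) j.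
rewrite -[RHS](@bseq_unique (fun j => @step N (2 * j)) y) => [|j|j].
- by rewrite /Tcol0 /y oppr0 lattice_tau_T10 lattice_tau_trivial.
- exact: lattice_tau_neq0.
have -> : 2 * j = j - (- j) by lia.
by rewrite step_cross; congr (z _ _ * z _ _); lia.
Qed.

Lemma Tcol1_lattice_tau m : Tcol1 N m = z (1 - m) (1 + m).
Proof.
pose y (j : int) := z (1 - j) (1 + j).
rewrite -[RHS](@bseq_unique (fun j => @step N (2 * j)) y) => [|j|j].
- by rewrite /Tcol1 /y lattice_tau_trivial // -lattice_tau_T11.
- exact: lattice_tau_neq0.
have -> : 2 * j = (1 + j) - (1 - j) by lia.
by rewrite step_cross; congr (z _ _ * z _ _); lia.
Qed.

Lemma Tmn_lattice_tau m n : Tmn N m n = z (n - m) (n + m).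
Proof.
pose y (j : int) := z (j - m) (j + m).
rewrite -[RHS](@bseq_unique (fun j => @step N (2 * j - 1)) y) => [|j|j].
- by rewrite /Tmn Tcol0_lattice_tau Tcol1_lattice_tau /y !add0r.
- exact: lattice_tau_neq0.
have -> : 2 * j - 1 = (j - m) + (j + m) - 1 by lia.
by rewrite step_diag; congr (z _ _ * z _ _); lia.
Qed.

End Garnier.

Theorem theorem3p5 (N : nat) (hN : (0 < N)%N) (m n : int) :
  Tmn N m n =
  Nmn N m n * unichar (xs N) (ys N) (stair (ufun (n - m))) (stair (ufun (n + m))).
Proof. by rewrite Tmn_lattice_tau lattice_tau_unichar. Qed.
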